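(* Let $X$ be the Ornstein–Uhlenbeck type process $X_t=x+\int_0^t r(X_s-a)\,ds+Y_t$, where $r>0$, $a\in\mathbb R$ is fixed, $Y$ is the spectrally negative Lévy process $Y_t=ct+\sqrt{2\alpha_0}\,B_t-J_t$ described in the context, with $c>0$ and $\alpha_0\ge0$ (so $X$ has drift function $c(x)=c+r(x-a)$ and $c=c(a)$). Let $q\ge0$, let $\mathbf w_q(\cdot,a)$ be the scale derivative of $X$, and let $\widehat{\mathbf w}_q(s,a)=\int_a^\infty e^{-s(y-a)}\mathbf w_q(y,a)\,dy$, $s>0$, be its shifted Laplace transform. Let $$I_q(s)=s^{q/r}\exp\Big(-\frac{\alpha_0}{2r}s^2-\frac cr s+\frac1r\int_0^s\widehat{\overline\Pi}(z)\,dz\Big),\qquad \overline I_q(s)=\int_s^\infty I_q(y)\,dy .$$ Then $$\widehat{\mathbf w}_q(s,a)=\frac{\overline I_q(s)}{r\,I_q(s)}-W_q(0)=\begin{cases}\dfrac{\overline I_q(s)}{r\,I_q(s)},&\text{if }Y\text{ has unbounded variation }(\alpha_0>0),\\[2mm]\dfrac{\overline I_q(s)}{r\,I_q(s)}-\dfrac1c,&\text{if }Y\text{ has bounded variation }(\alpha_0=0).\end{cases}$$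
   Context: $B$ is a standard Brownian motion and $J$ is an independent compound Poisson process with nonnegative jumps, with Lévy measure $\Pi$ on $(0,\infty)$ of finite total mass and finite mean. $\overline\Pi(x)=\Pi((x,\infty))$ and $\widehat{\overline\Pi}(s)=\int_0^\infty e^{-sx}\overline\Pi(x)\,dx$. Set $\kappa(s)=\alpha_0s^2+cs-s\,\widehat{\overline\Pi}(s)-q$ (the Laplace exponent of $Y$ minus $q$). $W_q:[0,\infty)\to[0,\infty)$ is the $q$-scale function of $Y$, i.e. the function with $\int_0^\infty e^{-sx}W_q(x)\,dx=1/\kappa(s)$ for all large $s$; $W_q(0)=0$ if $\alpha_0>0$ and $W_q(0)=1/c$ if $\alpha_0=0$. Its derivative on $(0,\infty)$ is denoted $w_q$. The scale derivative $\mathbf w_q(x,a)$, $x>a$, is the derivative in $x$ of the two-variable scale function $\mathcal W_q(x,a)$ of $X$; it is characterized (standing assumption for drifts of this type) by the Volterra renewal equation $$w_q(x-a)+\int_a^xw_q(x-z)\,\mathbf w_q(z,a)\,\big(c(a)-c(z)\big)\,dz=\begin{cases}\mathbf w_q(x,a),&Y\text{ of unbounded variation},\\ \mathbf w_q(x,a)\,\dfrac{c(x)}{c(a)},&Y\text{ of bounded variation},\end{cases}\qquad x>a,$$ where $c(x)=c+r(x-a)$. It is nonnegative and its Laplace transform $\widehat{\mathbf w}_q(s,a)$ is assumed to be finite for $s>0$. *)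

(* Defs.v *)
From mathcomp Require Import all_boot all_order all_algebra.
From mathcomp Require Import all_classical all_reals all_analysis.

Set Implicit Arguments.
Unset Strict Implicit.
Unset Printing Implicit Defensive.

Import Order.TTheory GRing.Theory Num.Theory.
Import numFieldNormedType.Exports.

Local Open Scope classical_set_scope.
Local Open Scope ring_scope.

Section independence.
Context d (Omega : measurableType d) (R : realType) (P : probability Omega R).

Definition sigma_of d' (T : measurableType d') (I : Type) (D : set I)
    (X : I -> Omega -> T) : set_system Omega :=
  <<s [set E | exists i A, [/\ D i, measurable A & E = X i @^-1` A] ] >>.

Definition independent (F G : set_system Omega) : Prop :=
  forall E E', F E -> G E' -> P (E `&` E') = (P E * P E')%E.

Definition mutually_independent (I : choiceType) (F : I -> set_system Omega)
    : Prop :=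
  forall (s : seq I) (E : I -> set Omega), uniq s ->
    (forall i, i \in s -> F i (E i)) ->
    P (\bigcap_(i in [set` s]) E i) = (\prod_(i <- s) P (E i))%E.

End independence.

(* Processes are indexed by all reals; only times t >= 0 are meaningful. *)
Section processes.
Context d (Omega : measurableType d) (R : realType) (P : probability Omega R).
Local Notation mu := (@lebesgue_measure R).

Record brownian_motion (B : R -> {mfun Omega >-> R}) : Prop := {
  brownian_start : {ae P, forall w, B 0 w = 0};
  brownian_continuous :
    {ae P, forall w, {within `[0, +oo[, continuous (fun t : R => B t w)}};
  brownian_independent_increments : forall s t : R, 0 <= s -> s < t ->
    independent P (sigma_of `[0, s] (fun (u : R) w => B u w))
                  (sigma_of [set: unit] (fun _ w => B t w - B s w));
  brownian_normal_increments : forall (s t : R) (A : set R), 0 <= s -> s < t ->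
    measurable A ->
    P ((fun w => B t w - B s w) @^-1` A) = normal_prob 0 (Num.sqrt (t - s)) A
}.

Record poisson_process (lambda : R) (N : R -> {mfun Omega >-> nat}) : Prop := {
  poisson_start : {ae P, forall w, N 0 w = 0%N};
  poisson_nondecreasing : {ae P, forall w, forall s t : R, 0 <= s -> s <= t ->
    (N s w <= N t w)%N};
  poisson_right_continuous : {ae P, forall w, forall t : R, 0 <= t ->
    \forall u \near t^'+, N u w = N t w};
  poisson_independent_increments : forall s t : R, 0 <= s -> s < t ->
    independent P (sigma_of `[0, s] (fun (u : R) w => N u w))
                  (sigma_of [set: unit] (fun _ w => (N t w - N s w)%N));
  poisson_increments : forall (s t : R) (k : nat), 0 <= s -> s < t ->
    P [set w | (N t w - N s w)%N = k] =
    poisson_prob (lambda * (t - s)) k [set k]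
}.

(* The jump law of a compound Poisson process is Pi normalised by its total
   mass; the product form below also covers Pi = 0. *)
Definition compound_poisson (Pi : {finite_measure set R -> \bar R})
    (J : R -> {mfun Omega >-> R}) : Prop :=
  exists (N : R -> {mfun Omega >-> nat}) (xi : nat -> {mfun Omega >-> R}),
    [/\ poisson_process (fine (Pi setT)) N,
        mutually_independent P
          (fun i : nat => sigma_of [set: unit] (fun _ w => xi i w)),
        (forall (i : nat) (A : set R), measurable A ->
          Pi A = (Pi setT * P (xi i @^-1` A))%E),
        independent P (sigma_of `[0, +oo[ (fun (t : R) w => N t w))
                      (sigma_of [set: nat] (fun i w => xi i w)) &
        forall (t : R) w, 0 <= t -> J t w = \sum_(i < N t w) xi i w].

Definition levy_Y (c alpha0 : R) (B J : R -> Omega -> R) (t : R) (w : Omega)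
    : R :=
  c * t + Num.sqrt (2 * alpha0) * B t w - J t w.

Definition ou_type_process (r a : R) (Y : R -> Omega -> R) (x : R)
    (X : R -> Omega -> R) : Prop :=
  {ae P, forall w, forall t : R, 0 <= t ->
    mu.-integrable `[0, t] (fun s => (X s w)%:E) /\
    X t w = x + \int[mu]_(s in `[0, t]) (r * (X s w - a)) + Y t w}.

Definition passage_above (b : R) (X : R -> Omega -> R) (w : Omega) : \bar R :=
  ereal_inf [set t%:E | t in [set t : R | 0 <= t /\ b < X t w]].

Definition passage_below (a : R) (X : R -> Omega -> R) (w : Omega) : \bar R :=
  ereal_inf [set t%:E | t in [set t : R | 0 <= t /\ X t w < a]].

(* Two-sided exit identity: X x is the process started from x, and W x stands
   for the two-variable scale function at (x, a).  It fixes W up to a positive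
   factor; volterra_equation fixes the factor. *)
Definition exit_scale_function (q a : R) (X : R -> R -> Omega -> R) (W : R -> R)
    : Prop :=
  (forall x : R, a < x -> 0 < W x) /\
  forall x b : R, a < x -> x < b ->
    (\int[P]_w (if (passage_above b (X x) w < passage_below a (X x) w)%E
                then expR (- q * fine (passage_above b (X x) w))
                else 0)%:E)%E = (W x / W b)%:E.

End processes.

Section transforms.
Context (R : realType).
Local Notation mu := (@lebesgue_measure R).
Implicit Types (Pi : {finite_measure set R -> \bar R}) (W w : R -> R).

Definition tail Pi (x : R) : R := fine (Pi `]x, +oo[%classic).

Definition tail_laplace Pi (s : R) : R :=
  \int[mu]_(x in `]0, +oo[) (expR (- s * x) * tail Pi x).

Definition kappa (alpha0 c q : R) Pi (s : R) : R :=
  alpha0 * s ^+ 2 + c * s - s * tail_laplace Pi s - q.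

Definition shifted_laplace (a : R) w (s : R) : \bar R :=
  (\int[mu]_(y in `]a, +oo[) (expR (- s * (y - a)) * w y)%:E)%E.

Definition drift (c r a x : R) : R := c + r * (x - a).

(* Only the values W x for x >= 0 matter. The Laplace transform determines W
   only almost everywhere; the scale function is its continuous nondecreasing
   version. *)
Record scale_function (alpha0 c q : R) Pi W : Prop := {
  scale_ge0 : forall x : R, 0 <= x -> 0 <= W x;
  scale_nondecreasing : forall x y : R, 0 <= x -> x <= y -> W x <= W y;
  scale_fun_continuous : {within `[0, +oo[, continuous W};
  scale_at0 : W 0 = if 0 < alpha0 then 0 else c^-1;
  scale_laplace : \forall s \near +oo,
    shifted_laplace 0 W s = (kappa alpha0 c q Pi s)^-1%:E
}.

(* If alpha0 = 0, scale functions are not differentiable at atoms of Pi (shifted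
   by the left end point a); no condition is imposed at these countably many
   points.  If alpha0 > 0 or Pi has no atoms, w is the derivative of W on the
   whole of (a, +oo). *)
Definition scale_derivative (alpha0 : R) Pi (a : R) W w : Prop :=
  forall x : R, a < x -> (alpha0 = 0 -> Pi [set x - a] = 0%E) ->
    is_derive x (1 : R) W (w x).

(* The integral is taken in the extended reals, so that the equation entails
   integrability. *)
Definition volterra_equation (alpha0 c r a : R) (wq wa : R -> R) : Prop :=
  forall x : R, a < x ->
    ((wq (x - a))%:E +
     \int[mu]_(z in `]a, x[)
       (wq (x - z) * wa z * (drift c r a a - drift c r a z))%:E)%E =
    (if 0 < alpha0 then wa x
     else wa x * (drift c r a x / drift c r a a))%:E.

Definition I_q (alpha0 c r q : R) Pi (s : R) : R :=
  s `^ (q / r) *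
  expR (- (alpha0 / (2 * r)) * s ^+ 2 - c / r * s +
        r^-1 * \int[mu]_(z in `[0, s]) tail_laplace Pi z).

Definition Ibar_q (alpha0 c r q : R) Pi (s : R) : R :=
  \int[mu]_(y in `]s, +oo[) I_q alpha0 c r q Pi y.

End transforms.

(* Main.v *)
(* Taking Laplace transforms in the Volterra equation and using
   L w_q(s) = s / kappa(s) - W_q(0) gives, for all large s,
     s = r s m(s) + kappa(s) g(s),   g = L u + W_q(0),   m = L(y u(y)) = - g',
   where u is the scale derivative shifted to the half line.  After division by
   s^2 and transposition both sides are transforms of nonnegative functions, so
   injectivity of the Laplace transform extends the identity to all s > 0.  It is
   the linear equation g' = (kappa g - s) / (r s); since I_q' = - kappa I_q / (r s),
   (I_q g)' = - I_q / r, and integrating from s to infinity gives the formula.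
   The identity for L w_q needs W_q to be the integral of its derivative although
   it is only differentiable off the atoms of Pi; this holds for every continuous
   nondecreasing function differentiable off a countable set. *)
Require Import Defs.
From mathcomp Require Import all_boot all_order all_algebra.
From mathcomp Require Import all_classical all_reals all_analysis.
From mathcomp Require Import measurable_realfun ring lra.

Set Implicit Arguments.
Unset Strict Implicit.
Unset Printing Implicit Defensive.

Import Order.TTheory GRing.Theory Num.Theory.
Import numFieldNormedType.Exports.

Local Open Scope classical_set_scope.
Local Open Scope ring_scope.

(** * Laplace transform and convolution on the half line *)

(** The transformed Volterra equation is available only where the transform of W_q is 1 / kappa,
    that is for large s, while the formula is claimed for every s > 0, and kappa may vanish or be
    negative at small s. The gap is bridged without complex variables: two transforms that agree at
    the points s0 + k have a difference with vanishing exponential moments, and the kernel exp (-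
    exp (- n (y - x))), a series of exponentials in y, approximates the indicator of y > x. Adding
    W_q(0) to L u makes g the transform of u plus an atom at 0; this merges the two cases of the
    Volterra equation into one. In the fundamental theorem the derivative is not known in advance to
    be bounded or integrable, so it is truncated first. Both inequalities come from one monotonicity
    criterion, which tolerates a null set where the lower derivate is merely bounded below at each
    point, and a countable set where only continuity is known. Nonnegative functions with extended
    values postpone every finiteness question to the moment when real numbers are extracted. *)

Section half_line_laplace.
Context (R : realType).
Local Notation mu := (@lebesgue_measure R).
Implicit Types (f g : R -> \bar R) (s : R).
Local Open Scope ereal_scope.

(** Nonnegative extended values make every transform and convolution meaningful without
    integrability conditions. Vanishing for x <= 0 lets both be integrals over the whole line. *)
Definition half_line f := [/\ measurable_fun [set: R] f,
  forall x, 0 <= f x & forall x, (x <= 0)%R -> f x = 0].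

Definition laplace f s : \bar R := \int[mu]_x ((expR (- s * x))%:E * f x).

Definition convolution f g (x : R) : \bar R := \int[mu]_y (f (x - y)%R * g y).

Lemma measurable_expRM (D : set R) s :
  measurable_fun D (fun x : R => (expR (s * x))%:E).
Proof.
apply/measurable_EFinP; apply: measurable_funS measurableT _ _ => //.
by apply: measurableT_comp => //; exact: mulrl_measurable.
Qed.

(** The image of Lebesgue measure under a translation agrees with it on half-open intervals, hence
    on all measurable sets. *)
Lemma integral_translation f (a : R) :
  measurable_fun setT f -> (forall x, 0 <= f x) ->
  \int[mu]_x f (x + a)%R = \int[mu]_x f x.
Proof.
move=> mf f0.
have ma : measurable_fun (setT : set (measurableTypeR R)) (fun x : R => x + a : measurableTypeR R)%R.
  exact: measurable_funD.
rewrite -[LHS](@ge0_integral_pushforward _ _ (measurableTypeR R) (measurableTypeR R) R _ ma mu setT f)//.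
apply: eq_measure_integral => A mA _; apply/esym.
apply: (@lebesgue_measure_unique R (pushforward mu (fun x : R => x + a : measurableTypeR R)%R)) => //.
move=> _ [[x y] /= _ <-].
rewrite /pushforward lebesgue_measure_itv/=.
rewrite (_ : (fun x0 : R => (x0 + a)%R) @^-1` `]x, y] = `]x - a, y - a]%classic)%R.
  rewrite lebesgue_measure_itv/= !lte_fin ltrD2r.
  by case: ifPn => // _; rewrite -!EFinB; congr EFin; ring.
by apply/seteqP; split => z /=; rewrite !in_itv/= ltrBlDr lerBrDr.
Qed.

Lemma half_lineD f g : half_line f -> half_line g ->
  half_line (fun x => f x + g x).
Proof.
move=> [mf f0 fz] [mg g0 gz]; split.
- exact: emeasurable_funD.
- by move=> x; rewrite adde_ge0.
- by move=> x x0; rewrite fz// gz// adde0.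
Qed.

Lemma half_lineZ (k : R) f : (0 <= k)%R -> half_line f ->
  half_line (fun x => k%:E * f x).
Proof.
move=> k0 [mf f0 fz]; split.
- exact: measurable_funeM.
- by move=> x; rewrite mule_ge0.
- by move=> x x0; rewrite fz// mule0.
Qed.

Lemma laplace_ge0 f s : (forall x, 0 <= f x) -> 0 <= laplace f s.
Proof.
by move=> f0; apply: integral_ge0 => x _; rewrite mule_ge0 ?lee_fin ?expR_ge0.
Qed.

Lemma measurable_expRM_mul f s : measurable_fun setT f ->
  measurable_fun setT (fun x => (expR (- s * x))%:E * f x).
Proof. by move=> mf; apply: emeasurable_funM => //; exact: measurable_expRM. Qed.

Lemma laplaceD f g s : half_line f -> half_line g ->
  laplace (fun x => f x + g x) s = laplace f s + laplace g s.
Proof.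
move=> [mf f0 fz] [mg g0 gz]; rewrite /laplace -ge0_integralD//.
- by apply: eq_integral => x _; rewrite ge0_muleDr.
- by move=> x _; rewrite mule_ge0 ?lee_fin ?expR_ge0.
- exact: measurable_expRM_mul.
- by move=> x _; rewrite mule_ge0 ?lee_fin ?expR_ge0.
- exact: measurable_expRM_mul.
Qed.

Lemma laplaceZ (k : R) f s : (0 <= k)%R -> half_line f ->
  laplace (fun x => k%:E * f x) s = k%:E * laplace f s.
Proof.
move=> k0 [mf f0 fz]; rewrite /laplace -ge0_integralZl//.
- by apply: eq_integral => x _; rewrite muleCA.
- exact: measurable_expRM_mul.
- by move=> x _; rewrite mule_ge0 ?lee_fin ?expR_ge0.
Qed.

Lemma measurable_convolution_integrand f g :
  measurable_fun setT f -> measurable_fun setT g ->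
  measurable_fun [set: (measurableTypeR R * measurableTypeR R)%type]
    (fun z : R * R => f (z.1 - z.2)%R * g z.2).
Proof.
move=> mf mg; apply: emeasurable_funM.
  by apply: (measurableT_comp mf); apply: measurable_funB.
exact: (measurableT_comp mg).
Qed.

Lemma half_line_convolution f g : half_line f -> half_line g ->
  half_line (convolution f g).
Proof.
move=> [mf f0 fz] [mg g0 gz]; split.
- apply: (@measurable_fun_fubini_tonelli_F _ _ (measurableTypeR R)
    (measurableTypeR R) R mu (fun z : R * R => f (z.1 - z.2)%R * g z.2)).
    exact: measurable_convolution_integrand.
  by move=> z; rewrite mule_ge0.
- by move=> x; apply: integral_ge0 => y _; rewrite mule_ge0.
- move=> x x0; apply: integral0_eq => y _.
  have [y0|y0] := leP y 0%R; first by rewrite gz// mule0.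
  by rewrite fz ?mul0e// lerBlDr add0r (le_trans x0)// ltW.
Qed.

Lemma laplace_convolution f g s : half_line f -> half_line g ->
  laplace (convolution f g) s = laplace f s * laplace g s.
Proof.
move=> [mf f0 fz] [mg g0 gz].
have mh := measurable_convolution_integrand mf mg.
pose h (z : measurableTypeR R * measurableTypeR R) :=
  (expR (- s * z.1))%:E * (f (z.1 - z.2)%R * g z.2).
transitivity (\int[mu]_x \int[mu]_y h (x, y)).
  apply: eq_integral => x _; rewrite /convolution -ge0_integralZl//=.
  - apply: emeasurable_funM => //.
    by apply: (measurableT_comp mf); apply: measurable_funB.
  - by move=> y _; rewrite mule_ge0.

have h0 z : 0 <= h z by rewrite /h !mule_ge0// lee_fin expR_ge0.
rewrite (fubini_tonelli h)//; last first.
  apply: emeasurable_funM => //.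
  exact: (measurableT_comp (@measurable_expRM setT (- s)%R) measurable_fst).
transitivity (\int[mu]_y (laplace f s * ((expR (- s * y))%:E * g y))); last first.
  rewrite ge0_integralZl//.
  - exact: measurable_expRM_mul.
  - by move=> y _; rewrite mule_ge0 ?lee_fin ?expR_ge0.
  - exact: laplace_ge0.
apply: eq_integral => y _.
rewrite /laplace -ge0_integralZr//; last 3 first.
- exact: measurable_expRM_mul.
- by move=> x _; rewrite mule_ge0 ?lee_fin ?expR_ge0.
- by rewrite mule_ge0 ?lee_fin ?expR_ge0.
(* Replacing x by x + y splits the exponential into a factor in x and a factor in y. *)
rewrite -(@integral_translation (fun x => h (x, y)) y)//.
  apply: eq_integral => x _; rewrite /h/= addrK.
  rewrite mulrDr expRD EFinM -!muleA; congr (_ * _).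
  by rewrite muleCA.
rewrite /h /=; apply: emeasurable_funM; first exact: measurable_expRM.
apply: emeasurable_funM => //.
by apply: (measurableT_comp mf); apply: measurable_funB.
Qed.

(** Convolving with this function integrates from 0, and its transform is 1 / s; divisions by s are
    expressed through it. *)
Definition heaviside (x : R) : \bar R := (\1_`]0, +oo[%classic x)%:E.

Lemma half_line_heaviside : half_line heaviside.
Proof.
split=> [|x|x x0]; first exact/measurable_EFinP/measurable_indic.
  by rewrite lee_fin.
by rewrite /heaviside indicE memNset//= in_itv/= andbT; apply/negP; rewrite -leNgt.
Qed.

Lemma laplace_mkcond f s :
  laplace (f \_ `]0%R, +oo[) s = \int[mu]_(x in `]0%R, +oo[) ((expR (- s * x))%:E * f x).
Proof.
rewrite /laplace [RHS]integral_mkcond; apply: eq_integral => x _.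
by rewrite !patchE; case: ifPn => //; rewrite mule0.
Qed.

Lemma laplace_half_line f s : half_line f ->
  laplace f s = \int[mu]_(x in `]0%R, +oo[) ((expR (- s * x))%:E * f x).
Proof.
move=> [_ _ fz]; rewrite -laplace_mkcond; congr laplace.
apply/funext => x; rewrite patchE; case: ifPn => //.
rewrite notin_setE/= in_itv/= andbT => /negP; rewrite -leNgt => x0.
by rewrite fz.
Qed.

Lemma half_line_mkcond f : measurable_fun (`]0%R, +oo[%classic : set R) f ->
  (forall x, (0 < x)%R -> 0 <= f x) -> half_line (f \_ `]0%R, +oo[).
Proof.
move=> mf f0; split.
- exact/(measurable_restrictT _ _).1.
- move=> x; rewrite patchE; case: ifPn => //.
  by rewrite inE/= in_itv/= andbT; exact: f0.
- move=> x x0; rewrite patchE memNset//= in_itv/= andbT; apply/negP.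
  by rewrite -leNgt.
Qed.

Lemma laplace_heaviside s : (0 < s)%R -> laplace heaviside s = (s^-1)%:E.
Proof.
(* The exponential density of rate s has total mass 1; the factor s is divided out at the end. *)
move=> s0; have := integral_exponential_pdf s0.
rewrite (_ : (fun x => _) = (EFin \o (fun x => s * expR (- s * x))%R) \_ `[0%R, +oo[);
  last by rewrite restrict_EFin.
rewrite -integral_mkcond -integral_itv_obnd_cbnd; last first.
  apply/measurable_EFinP; apply: measurable_funTS; apply: measurable_funM => //.
  by apply/measurable_EFinP; exact: measurable_expRM.
rewrite (laplace_half_line _ half_line_heaviside) => h.
transitivity (\int[mu]_(x in `]0%R, +oo[) (expR (- s * x))%:E).
  apply: eq_integral => x x0; rewrite /heaviside indicE.
  by rewrite x0 mule1.
have : s%:E * \int[mu]_(x in `]0%R, +oo[) (expR (- s * x))%:E = 1.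
  rewrite -ge0_integralZl//; first exact: measurable_expRM.
  by rewrite lee_fin ltW.
move/(congr1 (fun z => (s^-1)%:E * z)).
by rewrite muleA -EFinM mulVf ?gt_eqF// mul1e mule1.
Qed.

End half_line_laplace.

(** * Monotonicity from lower derivates *)

Section straddle.
Context (R : realType).
Local Notation mu := (@lebesgue_measure R).
Implicit Types (H : R -> R) (x y t e : R).

(* With P an increment estimate, this bounds the lower derivate at t over
   intervals with t inside, at either end included. *)
Definition straddle x y t (P : R -> R -> Prop) :=
  exists2 d : R, 0 < d & forall a b, x <= a -> a <= t -> t <= b -> b <= y ->
    b - a < d -> P a b.

Lemma straddle_imply x y t (P Q : R -> R -> Prop) :
  (forall a b, a <= b -> P a b -> Q a b) ->
  straddle x y t P -> straddle x y t Q.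
Proof.
move=> PQ [d d0 dP]; exists d => // a b xa at_ tb yb bad.
by apply: PQ; [exact: le_trans tb|exact: dP].
Qed.

Lemma straddleI x y t (P Q : R -> R -> Prop) :
  straddle x y t P -> straddle x y t Q ->
  straddle x y t (fun a b => P a b /\ Q a b).
Proof.
move=> [d d0 dP] [d' d'0 dQ]; exists (Num.min d d').
  by rewrite lt_min d0.
by move=> a b xa at_ tb yb; rewrite lt_min => /andP[h h']; split; [exact: dP|exact: dQ].
Qed.

(** Let z be the supremum of the points where H has not fallen below H x. The local estimate on
    intervals ending at z shows that z is such a point, and on intervals starting at z it would lead
    beyond z if z < y. *)
Lemma le_of_straddle H x y : x <= y ->
  (forall t, x <= t -> t <= y -> straddle x y t (fun a b => H a <= H b)) ->
  H x <= H y.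
Proof.
move=> xy loc.
pose S := [set z | [/\ x <= z, z <= y & H x <= H z]].
have Sx : S x by split.
have supS : has_sup S by split; [exists x|exists y => z []].
pose z := sup S.
have xz : x <= z by apply: ub_le_sup => //; exact: supS.2.
have zy : z <= y by apply: ge_sup; [exact: supS.1|move=> w []].
have [d d0 dH] := loc z xz zy.
have Hz : H x <= H z.
  have [w [xw wy Hw] zw] := sup_adherent d0 supS.
  have wz : w <= z by apply: ub_le_sup => //; exact: supS.2.
  apply: le_trans Hw _; apply: dH => //.
  by rewrite ltrBlDr addrC -ltrBlDr.
have [yz|zy'] := leP y z; first by rewrite (@le_anti _ _ y z) ?yz.
pose w := Num.min y (z + d / 2).
have zw : z < w by rewrite lt_min zy' ltrDl divr_gt0.
have wy : w <= y by rewrite ge_min lexx.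
have : w <= z.
  apply: ub_le_sup; first exact: supS.2.
  split => //; first by rewrite (le_trans xz)// ltW.
  apply: le_trans Hz _; apply: dH => //; first exact: ltW.
  rewrite ltrBlDl; apply: (@le_lt_trans _ _ (z + d / 2)).
    by rewrite ge_min lexx orbT.
  by rewrite ltrD2l; lra.
by rewrite leNgt zw.
Qed.

Lemma open_straddle x y t (U : set R) : open U -> U t ->
  straddle x y t (fun a b => `]a, b] `<=` U).
Proof.
move=> oU Ut; have /nbhs_ballP[d /= d0 dU] := open_nbhs_nbhs (conj oU Ut).
exists d => // a b xa at_ tb yb bad z /=; rewrite in_itv/= => /andP[az zb].
by apply: dU; rewrite /ball/= ltr_distlC; apply/andP; split; lra.
Qed.

Lemma measure_itv_oc_split (U : set R) x a b : open U -> x <= a -> a <= b ->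
  mu (U `&` `]x, b]) = (mu (U `&` `]x, a]) + mu (U `&` `]a, b]))%E.
Proof.
move=> oU xa ab; have mU : measurable U := open_measurable oU.
rewrite (@itv_bndbnd_setU _ _ _ (BRight a))// setIUr measureU//.
- exact: measurableI.
- exact: measurableI.
- apply/seteqP; split => // z [[_ /=]]; rewrite !in_itv/= => /andP[_ za] [_ /andP[az _]].
  by rewrite leNgt az in za.
Qed.

(* F sums the measures of the traces of small open neighbourhoods of E and small
   jumps at the points t_ k. *)
Lemma null_set_majorant x y (E : set R) (t_ : nat -> R) e :
  x <= y -> measurable E -> mu E = 0%E -> 0 < e ->
  exists F : R -> R, [/\ 0 <= F x, F y <= e,
    forall a b, x <= a -> a <= b -> b <= y -> F a <= F b,
    forall t (K : R), E t -> x <= t -> t <= y ->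
      straddle x y t (fun a b => K * (b - a) <= F b - F a) &
    forall k, exists2 c, 0 < c & forall a b, x <= a -> a <= t_ k -> t_ k <= b -> b <= y ->
      a < b -> c <= F b - F a].
Proof.
move=> xy mE E0 e0.
(* The set [U k] costs at most [c k] and the jumps at [t_ k] cost [2 * c k], so the k-th term is at
   most e / 2 ^ k.+1 and the series at most e. *)
pose c k := e / 3 / (2 ^ k.+1)%:R.
have c0 k : 0 < c k by rewrite !divr_gt0// ltr0n expn_gt0.
have hU k : exists U : set R, [/\ open U, E `<=` U & (mu U <= (c k)%:E)%E].
  have Eoo : (mu E < +oo)%E by rewrite E0 ltry.
  have [U [oU EU UE]] := lebesgue_regularity_outer mE Eoo (c0 k).
  have mUE : measurable (U `\` E).
    by apply: measurableD => //; exact: open_measurable.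
  have UEE : (U `\` E) `&` E = set0 by apply/seteqP; split => // z [[]].
  exists U; split => //; rewrite -(setDKU EU).
  have -> : mu (U `\` E `|` E) = (mu (U `\` E) + mu E)%E by exact: measureU.
  by rewrite E0 adde0 ltW.
have [U HU] := choice hU.
(* The values 0, 1, 2 before, at and after [t_ k] give a unit jump on each side, so that an interval
   with [t_ k] as an endpoint still gains one jump. *)
pose j k t : R := (t_ k < t)%R%:R + (t_ k <= t)%R%:R.
pose f k t : \bar R := (mu (U k `&` `]x, t]) + (c k * j k t)%:E)%E.
have f0 k t : (0 <= f k t)%E.
  by rewrite adde_ge0// lee_fin mulr_ge0 ?addr_ge0// ?ltW.
have fle k t : (f k t <= (3 * c k)%:E)%E.
  have [oU _ muU] := HU k.
  rewrite (_ : 3 * c k = c k + 2 * c k); last by ring.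
  rewrite EFinD leeD//.
    have mU : measurable (U k) := open_measurable oU.
    by apply: le_trans muU; apply: le_measure; rewrite ?inE//; exact: measurableI.
  rewrite lee_fin mulrC ler_pM2r// /j; case: (t_ k < t); case: (t_ k <= t); rewrite /=; lra.
have fS a b k : x <= a -> a <= b ->
    f k b = (f k a + (mu (U k `&` `]a, b]) +
     (c k * (j k b - j k a))%:E))%E.
  move=> xa ab; have [oU _ _] := HU k.
  rewrite /f (measure_itv_oc_split oU xa ab).
  rewrite addeACA -EFinD; congr (_ + _%:E)%E; ring.
have step a b k : a <= b -> 0 <= c k * (j k b - j k a).
  move=> ab; apply: mulr_ge0; first exact: ltW.
  have h1 : (t_ k < a)%R%:R <= (t_ k < b)%R%:R :> R.
    by rewrite ler_nat; case: (ltP (t_ k) a) => // ta; rewrite (lt_le_trans ta ab).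
  have h2 : (t_ k <= a)%R%:R <= (t_ k <= b)%R%:R :> R.
    by rewrite ler_nat; case: (leP (t_ k) a) => // ta; rewrite (le_trans ta ab).
  by rewrite subr_ge0; exact: lerD.
pose G t := (\sum_(k <oo) f k t)%E.
have G0 t : (0 <= G t)%E by apply: nneseries_ge0.
have Gle t : (G t <= e%:E)%E.
  apply: (@le_trans _ _ (\sum_(k <oo) (e / (2 ^ k.+1)%:R)%:E)%E); last first.
    by apply: epsilon_trick0; exact: ltW.
  apply: lee_nneseries => // k _; apply: le_trans (fle k t) _.
  by rewrite lee_fin /c le_eqVlt; apply/orP; left; apply/eqP; field; rewrite pnatr_eq0 -lt0n expn_gt0.
have Gfin t : G t \is a fin_num.
  by rewrite ge0_fin_numE// (le_lt_trans (Gle t))// ltry.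
(* A finite sum of lower bounds for the increments of the terms is a lower bound for the increment
   of the series. *)
have GS a b (r : R) (n : nat) (g : nat -> R) : x <= a -> a <= b ->
   (forall k, 0 <= g k) ->
   (forall k, ((g k)%:E <= mu (U k `&` `]a, b]) +
     (c k * (j k b - j k a))%:E)%E) ->
   r <= \sum_(0 <= k < n) g k -> r <= fine (G b) - fine (G a).
  move=> xa ab g0 gf rg; apply: le_trans rg _.
  rewrite lerBrDl -lee_fin EFinD !fineK//.
  apply: (@le_trans _ _ (G a + \sum_(k <oo) (g k)%:E)%E).
    rewrite leeD2l// -sumEFin; apply: nneseries_lim_ge => k _ _.
    by rewrite lee_fin.
  rewrite /G -nneseriesD//; last by move=> k _ _; rewrite lee_fin.
  apply: lee_nneseries => [k _ _|k _]; first by rewrite adde_ge0// lee_fin.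
  by rewrite (fS a b)// leeD2l.
exists (fun t => fine (G t)); split.
- exact: fine_ge0.
- by rewrite -lee_fin fineK.
- move=> a b xa ab yb; rewrite -subr_ge0.
  apply: (GS a b 0 0%N (fun=> 0)) => // [k|]; last by rewrite big_geq.
  by rewrite adde_ge0// lee_fin step.
- move=> t K Et xt ty.
  (* A short interval around t lies in each of the first n sets [U k]; each contributes its length b
     - a, and n is at least K. *)
  pose n := `|Num.ceil K|%N.
  have Kn : K <= n%:R.
    apply: le_trans (ceil_ge K) _; rewrite /n natr_absz ler_int; exact: ler_norm.
  have [d d0 dU] : straddle x y t (fun a b => forall k, (k < n)%N -> `]a, b] `<=` U k).
    elim: (n) => [|m IH]; first by exists 1.
    have [oU EU _] := HU m.
    apply: straddle_imply (straddleI IH (open_straddle x y oU (EU _ Et))) => a b ab [h1 h2] k.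
    by rewrite ltnS leq_eqVlt => /orP[/eqP->//|]; exact: h1.
  exists d => // a b xa at_ tb yb bad.
  have ab := le_trans at_ tb.
  apply: (GS a b _ n (fun k => if (k < n)%N then b - a else 0)) => // [k|k|].
  + by case: ifPn => // _; rewrite subr_ge0.
  + case: ifPn => kn; last by rewrite adde_ge0// lee_fin step.
    rewrite -[leLHS]adde0 leeD//; last by rewrite lee_fin step.
    rewrite (_ : U k `&` `]a, b] = `]a, b]%classic); last first.
      by apply/setIidPr; exact: (dU a b).
    rewrite lebesgue_measure_itv/= lte_fin.
    by move: ab; rewrite le_eqVlt => /orP[/eqP->|->//]; rewrite ltxx subrr.
  + rewrite big_nat_cond (eq_bigr (fun=> b - a)); last first.
      by move=> k /andP[/andP[_ ->]].
    rewrite -big_nat_cond sumr_const_nat subn0 -[leRHS]mulr_natl ler_wpM2r// subr_ge0//.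
- move=> k; exists (c k) => // a b xa at_ tb yb altb.
  have ab := ltW altb.
  apply: (GS a b _ k.+1 (fun i => if (i == k) then c k else 0)) => // [i|i|].
  + by case: ifPn => // _; rewrite ltW.
  + case: ifPn => [/eqP ->|kn]; last by rewrite adde_ge0// lee_fin step.
    rewrite -[leLHS]add0e leeD// lee_fin; apply: ler_peMr; first exact: ltW.
    rewrite /j tb (ltNge (t_ k) a) at_ /=.
    have [tkb|btk] := ltP (t_ k) b; first by case: (t_ k <= a) => /=; lra.
    have -> : (t_ k <= a) = false by apply/negbTE; rewrite -ltNge (lt_le_trans altb).
    by move=> /=; lra.
  + by rewrite big_nat_recr//= eqxx lerDr sumr_ge0// => i _; case: ifPn => // _; rewrite ltW.
Qed.

(* Adding to H a small slope and a small majorant of the exceptional sets makes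
   it locally nondecreasing at every point. *)
Lemma le_of_straddle_ae H x y (E : set R) (t_ : nat -> R) :
  x <= y -> measurable E -> mu E = 0%E ->
  (forall t e, x <= t -> t <= y -> ~ E t -> 0 < e ->
    straddle x y t (fun a b => - (e * (b - a)) <= H b - H a)) ->
  (forall t, x <= t -> t <= y -> ~ range t_ t ->
    exists K, straddle x y t (fun a b => - (K * (b - a)) <= H b - H a)) ->
  (forall t e, x <= t -> t <= y -> 0 < e ->
    straddle x y t (fun a b => - e <= H b - H a)) ->
  H x <= H y.
Proof.
move=> xy mE E0 HE HK Hc; apply/ler_addgt0Pr => e e0.
(* The slope [e1] costs at most e / 2 over the whole interval and the majorant F another e / 2. The
   summand 1 keeps the denominator positive when x = y. *)
pose e1 := e / 2 / (1 + (y - x)).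
have yx0 : 0 < 1 + (y - x) by rewrite ltr_pwDl// subr_ge0.
have e10 : 0 < e1 by rewrite !divr_gt0.
have e20 : 0 < e / 2 by rewrite divr_gt0.
have [F [Fx Fy ndF FE Ft]] := null_set_majorant t_ xy mE E0 e20.
have : H x + e1 * x + F x <= H y + e1 * y + F y.
  apply: (@le_of_straddle (fun t => H t + e1 * t + F t)) => // t xt ty.
  (* At a point [t_ k] the jump of F outweighs the possible drop of H; on E the steepness of F
     outweighs the slope - K; elsewhere the linear term suffices. *)
  have [[k _ tk]|tN] := pselect (range t_ t).
    have [c c0 Fc] := Ft k.
    have [d d0 dH] := Hc t c xt ty c0.
    exists d => // a b xa at_ tb yb bad.
    have [->//|ab] := eqVneq a b.
    have altb : a < b by rewrite lt_neqAle ab (le_trans at_ tb).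
    have := dH a b xa at_ tb yb bad.
    have : e1 * a <= e1 * b by rewrite ler_pM2l// ltW.
    rewrite -tk in at_ tb.
    by have := Fc a b xa at_ tb yb altb; lra.
  have [tE|tE] := pselect (E t).
    have [K HtK] := HK t xt ty tN.
    apply: straddle_imply (straddleI HtK (FE t K tE xt ty)) => a b ab [h1 h2].
    have : e1 * a <= e1 * b by rewrite ler_pM2l.
    lra.
  have [d d0 dH] := HE t e1 xt ty tE e10.
  exists d => // a b xa at_ tb yb bad.
  have := dH a b xa at_ tb yb bad.
  have := ndF a b xa (le_trans at_ tb) yb.
  by rewrite mulrBr; lra.
have : e1 * (y - x) <= e / 2.
  by rewrite /e1 -mulrA ger_pMr// ler_pdivrMl// mulr1 lerDr.
by rewrite mulrBr; lra.
Qed.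

End straddle.

(** * Fundamental theorem of calculus for monotone functions *)

Section derivative_straddle.
Context (R : realType).
Local Notation mu := (@lebesgue_measure R).
Implicit Types (H f : R -> R) (x y t e l : R).

Lemma is_derive_bound H t l e : is_derive t 1 H l -> 0 < e ->
  exists2 d : R, 0 < d & forall s, `|s - t| < d -> `|H s - H t - l * (s - t)| <= e * `|s - t|.
Proof.
move=> [dH dl] e0.
have : h^-1 *: ((H \o shift t) (h *: 1) - H t) @[h --> 0^'] --> l.
  by rewrite -dl; exact: dH.
move=> /cvgrPdist_le /(_ e e0) /nbhs_ballP[d /= d0 dP].
exists d => // s st.
have [->|sNt] := eqVneq s t; first by rewrite !subrr mulr0 subrr normr0 mulr0.
have st0 : s - t != 0 by rewrite subr_eq0.
have : `|l - (s - t)^-1 *: (H ((s - t) *: 1 + t) - H t)| <= e.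
  by apply: (dP (s - t)) => //; rewrite /ball/= sub0r normrN.
rewrite /GRing.scale/= mulr1 subrK => h.
rewrite (_ : H s - H t - l * (s - t) = - (l - (s - t)^-1 * (H s - H t)) * (s - t)).
  by rewrite normrM normrN ler_wpM2r.
by field.
Qed.

(** The errors at the two ends are e (t - a) and e (b - t), which add up to e (b - a) because t lies
    between a and b. *)
Lemma is_derive_straddle H t l x y e : is_derive t 1 H l -> 0 < e ->
  straddle x y t (fun a b => `|H b - H a - l * (b - a)| <= e * (b - a)).
Proof.
move=> dH e0; have [d d0 dP] := is_derive_bound dH e0.
exists d => // a b xa at_ tb yb bad.
have /dP : `|a - t| < d by rewrite distrC ger0_norm ?subr_ge0//; lra.
have /dP : `|b - t| < d by rewrite ger0_norm ?subr_ge0//; lra.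
rewrite (distrC a t) (@ger0_norm _ (b - t)) ?subr_ge0//.
rewrite (@ger0_norm _ (t - a)) ?subr_ge0// => h1 h2.
have -> : H b - H a - l * (b - a) = (H b - H t - l * (b - t)) - (H a - H t - l * (a - t)) by ring.
apply: le_trans (ler_normB _ _) _.
by apply: le_trans (lerD h1 h2) _; rewrite -mulrDr; apply: ler_wpM2l; [exact: ltW|lra].
Qed.

Lemma continuous_straddle H t x y e : {for t, continuous H} -> 0 < e ->
  straddle x y t (fun a b => `|H b - H a| <= e).
Proof.
move=> /cvgrPdist_le cH e0.
have /cH/nbhs_ballP[d /= d0 dP] : 0 < e / 2 by rewrite divr_gt0.
exists d => // a b xa at_ tb yb bad.
have h1 : `|H t - H a| <= e / 2.
  by apply: dP; rewrite /ball/= ger0_norm ?subr_ge0//; lra.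
have h2 : `|H t - H b| <= e / 2.
  by apply: dP; rewrite /ball/= distrC ger0_norm ?subr_ge0//; lra.
have -> : H b - H a = (H t - H a) - (H t - H b) by ring.
by apply: le_trans (ler_normB _ _) _; lra.
Qed.

Lemma nondecreasing_is_derive_ge0 H t l : {homo H : a b / a <= b} ->
  is_derive t 1 H l -> 0 <= l.
Proof.
move=> ndH dH; rewrite leNgt; apply/negP => l0.
have e0 : 0 < - l / 2 by rewrite divr_gt0// oppr_gt0.
have [d d0 dP] := is_derive_bound dH e0.
have /dP : `|t + d / 2 - t| < d by rewrite addrC addKr ger0_norm; lra.
have -> : t + d / 2 - t = d / 2 by ring.
rewrite (ger0_norm (_ : 0 <= d / 2)); last lra.
rewrite ler_norml => /andP[_].
have : H t <= H (t + d / 2) by apply: ndH; rewrite lerDl; lra.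
have : 0 < - l * (d / 2) by rewrite mulr_gt0; lra.
lra.
Qed.

(** An inclusion rather than an equality, so that finite and empty sets are covered; codes that no
    point of A carries are sent to 0. *)
Lemma countable_range (A : set R) : countable A ->
  exists t_ : nat -> R, A `<=` range t_.
Proof.
move=> /countable_injP[f finj].
have ex n : exists x, forall z, A z -> f z = n -> z = x.
  have [[z [Az fz]]|h] := pselect (exists z, A z /\ f z = n).
    by exists z => z' Az' fz'; apply: finj; rewrite ?inE// fz'.
  by exists 0 => z Az fz; exfalso; apply: h; exists z.
have [t_ ht] := choice ex.
by exists t_ => z Az; exists (f z) => //; rewrite -(ht _ z).
Qed.

Lemma countable_measurableR (A : set R) : countable A -> measurable A.
Proof. by apply: countable_measurable => t; exact: measurable_set1. Qed.

Lemma integrable_restrict f (D : set R) : measurable D ->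
  mu.-integrable D (EFin \o f) -> mu.-integrable setT (EFin \o (f \_ D)).
Proof. by move=> mD; rewrite integrable_mkcond// restrict_EFin. Qed.

Lemma FTC_null_set f : mu.-integrable setT (EFin \o f) ->
  exists E : set R, [/\ measurable E, mu E = 0%E &
    forall t, ~ E t -> is_derive t 1 (fun x : R => \int[mu]_(s in `]-oo, x]) f s) (f t)].
Proof.
move=> intf.
have locf : locally_integrable setT f.
  by apply: open_integrable_locally => //; exact: openT.
have intfy y : mu.-integrable `]-oo, y] (EFin \o f) by exact: integrableS intf.
have [E [mE E0 sE]] := FTC1Ny intfy locf.
exists E; split => // t Et.
have [df fE] : derivable (fun x : R => \int[mu]_(s in `]-oo, x]) f s) t 1 /\
    (fun x : R => \int[mu]_(s in `]-oo, x]) f s)^`()%classic t = f t.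
  by apply: contrapT => h; apply: Et; exact: sE.
by apply: DeriveDef; [exact: df|rewrite -derive1E; exact: fE].
Qed.

Lemma Rintegral_increment f a b : mu.-integrable setT (EFin \o f) -> a <= b ->
  \int[mu]_(s in `]-oo, b]) f s - \int[mu]_(s in `]-oo, a]) f s =
  \int[mu]_(s in `]a, b]) f s.
Proof.
move=> intf ab; apply: Rintegral_itvB => //; exact: integrableS intf.
Qed.

Lemma Rintegral_itv_le f a b M : mu.-integrable setT (EFin \o f) -> a <= b ->
  (forall s, f s <= M) -> \int[mu]_(s in `]a, b]) f s <= M * (b - a).
Proof.
move=> intf ab fM.
have : \int[mu]_(s in `]a, b]) f s <= \int[mu]_(s in `]a, b]) cst M s.
  apply: le_Rintegral => //; first exact: integrableS intf.
  apply: measurable_bounded_integrable => //; last by exists `|M|; split => // ? ? ? _ /=; rewrite ltW.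
  by have /= -> := lebesgue_measure_itv `]a, b]; case: ifPn => _; rewrite -?EFinB ltry.
rewrite Rintegral_cst//; have /= -> := lebesgue_measure_itv `]a, b].
rewrite lte_fin; move: ab; rewrite le_eqVlt => /orP[/eqP ->|->//].
by rewrite ltxx subrr.
Qed.

End derivative_straddle.

Section monotone_FTC.
Context (R : realType).
Local Notation mu := (@lebesgue_measure R).
Variables (W w : R -> R) (N : set R).
Hypothesis ndW : {homo W : a b / a <= b}.
Hypothesis cW : continuous W.
Hypothesis cN : countable N.
Hypothesis dW : forall t, 0 < t -> ~ N t -> is_derive t 1 W (w t).

Lemma monotone_derivative_ge0 t : 0 < t -> ~ N t -> 0 <= w t.
Proof. by move=> t0 Nt; apply: nondecreasing_is_derive_ge0 (dW t0 Nt). Qed.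

(** Off N the function is a pointwise limit of difference quotients of W; on the countable set N
    every function is measurable. *)
Lemma monotone_derivative_measurable : measurable_fun (`]0, +oo[%classic : set R) w.
Proof.
have mN : measurable N := countable_measurableR cN.
rewrite (_ : `]0, +oo[%classic = (`]0, +oo[%classic `\` N) `|` (`]0, +oo[%classic `&` N)); last first.
  by rewrite setUC setUIDK.
apply/measurable_funU; [exact: measurableD|exact: measurableI|split].
- pose h n t := n.+1%:R * (W (t + n.+1%:R^-1) - W t).
  apply: (@measurable_fun_cvg _ _ _ _ h) => [n|t [/= t0 Nt]].
    apply: measurable_funTS; apply: measurable_funM => //.
    apply: measurable_funB; last exact: continuous_measurable_fun.
    apply: nondecreasing_measurable => // a b ab; apply: ndW.
    by rewrite lerD2r.
  have {}t0 : 0 < t by move: t0; rewrite in_itv/= andbT.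
  apply/cvgrPdist_le => e e0.
  have [d d0 dP] := is_derive_bound (dW t0 Nt) e0.
  near=> n.
  have nd : n.+1%:R^-1 < d.
    by near: n; exact: near_infty_natSinv_lt (PosNum d0).
  have n0 : 0 < n.+1%:R^-1 :> R by rewrite invr_gt0.
  have tz : t + n.+1%:R^-1 - t = n.+1%:R^-1 by rewrite addrC addKr.
  have /dP : `|t + n.+1%:R^-1 - t| < d by rewrite tz gtr0_norm.
  rewrite tz (gtr0_norm n0) => hle.
  rewrite distrC (_ : h n t - w t = (W (t + n.+1%:R^-1) - W t - w t * n.+1%:R^-1) * n.+1%:R).
    by rewrite normrM [X in _ * X]gtr0_norm// -ler_pdivlMr.
  by rewrite /h mulrBl -mulrA mulVf ?mulr1 1?mulrC.
- move=> _ Y mY; apply: countable_measurableR.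
  by apply: sub_countable cN; apply: subset_card_le => z [[]].
Unshelve. all: by end_near. Qed.

Let v t : R := Num.max (w t) 0.

Let v_ge0 t : 0 <= v t. Proof. by rewrite /v le_max lexx orbT. Qed.

Let vE t : 0 < t -> ~ N t -> v t = w t.
Proof.
by move=> t0 Nt; apply/max_idPl; exact: monotone_derivative_ge0.
Qed.

Let measurable_v (y : R) : measurable_fun (`]0, y]%classic : set R) v.
Proof.
apply: (@measurable_funS _ _ _ _ (`]0, +oo[%classic : set R)) => //.
  by apply: subset_itvl.
by apply: measurable_maxr => //; exact: monotone_derivative_measurable.
Qed.

(** Prepares the exceptional sets for [le_of_straddle_ae]. The point 0 joins N because W is
    differentiated only at positive points, and E joins both to the null set where F may fail to
    have derivative f. *)
Let FTC_setup (y : R) (f : R -> R) : 0 <= y ->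
  mu.-integrable setT (EFin \o f) -> (forall t, 0 <= f t) ->
  let F (x : R) := \int[mu]_(s in `]-oo, x]) f s in
  exists (E : set R) (t_ : nat -> R), [/\ measurable E, mu E = 0%E,
    forall t : R, 0 <= t -> ~ range t_ t -> 0 < t /\ ~ N t,
    forall t : R, 0 <= t -> ~ E t -> [/\ 0 < t, ~ N t & is_derive t 1 F (f t)] &
    forall a b : R, a <= b -> F a <= F b].
Proof.
move=> y0 intf f0 F.
have [E [mE E0 dF]] := FTC_null_set intf.
have cN0 : countable (N `|` [set 0]).
  rewrite (_ : _ `|` _ = \bigcup_(b in [set: bool]) (if b then N else [set 0])).
    by apply: bigcup_countable => // -[].
  apply/seteqP; split => [z [?|?]|z [[] _ ?]]; by [exists true|exists false|left|right].
have [t_ Nt_] := countable_range cN0.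
have mN0 := countable_measurableR cN0.
have muN0 := countable_lebesgue_measure0 cN0.
have E0' : (mu E <= 0)%E by rewrite E0.
have muN0' : (mu (N `|` [set 0%R]) <= 0)%E by rewrite muN0.
exists (E `|` (N `|` [set 0])), t_; split.
- exact: measurableU.
- apply/eqP; rewrite -measure_le0; apply: le_trans; first exact: measureU2.
  by rewrite -[leRHS](adde0 0%E); apply: leeD; [exact: E0'|exact: muN0'].
- move=> t t0 Nt; split.
    by rewrite lt_neqAle t0 andbT; apply/eqP => t00; apply: Nt; apply: Nt_; right.
  by move=> tN; apply: Nt; apply: Nt_; left.
- move=> t t0 Et; split.
  + rewrite lt_neqAle t0 andbT; apply/eqP => t00; apply: Et; right; right.
    by rewrite -t00.
  + by move=> tN; apply: Et; right; left.
  + by apply: dF => tE; apply: Et; left.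
- move=> a b ab; rewrite -subr_ge0 Rintegral_increment//.
  by apply: Rintegral_ge0 => t _.
Qed.

(** Truncation makes the primitive F Lipschitz with constant M. As W is nondecreasing, W - F then
    never falls faster than slope M, even at the points of the null set where F has no
    derivative. *)
Lemma monotone_truncated_FTC (y M : R) : 0 <= y -> 0 < M ->
  (\int[mu]_(t in `]0%R, y]) (Num.min (v t) M)%:E <= (W y - W 0)%:E)%E.
Proof.
move=> y0 M0.
pose f := (fun t => Num.min (v t) M) \_ `]0, y].
have mf0 : measurable_fun (`]0, y]%classic : set R) (fun t => Num.min (v t) M).
  by apply: measurable_minr => //; exact: measurable_v.
have minM t : 0 <= Num.min (v t) M <= M.
  by rewrite ge_min lexx orbT andbT le_min v_ge0 ltW.
have int0 : mu.-integrable (`]0, y]%classic : set R) (EFin \o (fun t => Num.min (v t) M)).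
  apply: measurable_bounded_integrable => //.
    by have /= -> := lebesgue_measure_itv `]0, y]; case: ifPn => _; rewrite -?EFinB ltry.
  exists M; split; first exact: num_real.
  move=> K MK t _ /=.
  by have /andP[h1 h2] := minM t; rewrite ger0_norm// (le_trans h2)// ltW.
have intf : mu.-integrable setT (EFin \o f).
  exact: integrable_restrict.
have f0 t : 0 <= f t.
  by rewrite /f patchE; case: ifPn => // _; have /andP[] := minM t.
have fM t : f t <= M.
  by rewrite /f patchE; case: ifPn => // _; [have /andP[] := minM t|exact: ltW].
have [E [t_ [mE E0 Nt Et ndF]]] := FTC_setup y0 intf f0.
set F := fun x : R => \int[mu]_(s in `]-oo, x]) f s in Et ndF.
have {}ndF a b : a <= b -> F a <= F b by exact: ndF.
have FM a b : a <= b -> F b - F a <= M * (b - a).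
  by move=> ab; rewrite /F Rintegral_increment//; exact: Rintegral_itv_le.
have H : W 0 - F 0 <= W y - F y.
  apply: (@le_of_straddle_ae _ (fun x => W x - F x) 0 y E t_) => //.
  - move=> t e t0 ty tE e0.
    have [tt0 tN dF] := Et t t0 tE.
    have e20 : 0 < e / 2 by rewrite divr_gt0.
    apply: straddle_imply (straddleI (is_derive_straddle 0 y (dW tt0 tN) e20)
      (is_derive_straddle 0 y dF e20)) => a b ab [].
    rewrite !ler_norml => /andP[h1 _] /andP[_ h2].
    have : f t * (b - a) <= w t * (b - a).
      apply: ler_wpM2r; first by rewrite subr_ge0.
      rewrite /f patchE mem_set//=; last by rewrite in_itv/= tt0.
      by rewrite -(vE tt0 tN) ge_min lexx.
    lra.
  - move=> t t0 ty tN; exists M; exists 1 => // a b a0 at_ tb yb _.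
    have ab := le_trans at_ tb.
    by have := FM a b ab; have := ndW ab; lra.
  - move=> t e t0 ty e0; exists (e / M); first by rewrite divr_gt0.
    move=> a b a0 at_ tb yb; rewrite ltr_pdivlMr// => bae.
    have ab := le_trans at_ tb.
    by have := FM a b ab; have := ndW ab; rewrite mulrC in bae; lra.
have : \int[mu]_(t in `]0%R, y]) (Num.min (v t) M) <= W y - W 0.
  rewrite (_ : \int[mu]_(t in _) _ = F y - F 0); first lra.
  rewrite /F Rintegral_increment//; apply: eq_Rintegral => t ty.
  by rewrite /f patchE ty.
rewrite -lee_fin /Rintegral fineK//; exact: integrable_fin_num.
Qed.

(** Letting the truncation level grow gives one inequality and the integrability of [v]. The other
    applies the criterion to F - W: F is nondecreasing, so a drop can only come from W, which has a
    finite derivative at positive points off N and is continuous everywhere. *)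
Lemma monotone_FTC (y : R) : 0 <= y ->
  (\int[mu]_(t in `]0%R, y]) (v t)%:E = (W y - W 0)%:E)%E.
Proof.
move=> y0.
have le : (\int[mu]_(t in `]0%R, y]) (v t)%:E <= (W y - W 0)%:E)%E.
  have -> : (\int[mu]_(t in `]0%R, y]) (v t)%:E =
      \int[mu]_(t in `]0%R, y]) limn (fun n : nat => (Num.min (v t) n.+1%:R)%:E))%E.
    apply: eq_integral => t _; apply/esym/cvg_lim => //.
    apply: cvg_near_cst; near=> n.
    congr EFin; apply/min_idPl.
    near: n; exists `|Num.ceil (v t)|%N => // n /= vn.
    apply: le_trans (ceil_ge _) _; apply: le_trans (ler_norm _) _.
    by rewrite -intr_norm -natr_absz ler_nat ltnW.
  have cvgI := @cvg_monotone_convergence _ _ _ mu (`]0, y]%classic : set R)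
    (measurable_itv _) (fun n t => (Num.min (v t) n.+1%:R)%:E).
  have {}cvgI : (\int[mu]_(t in `]0%R, y]) (Num.min (v t) n.+1%:R)%:E @[n --> \oo] -->
      \int[mu]_(t in `]0%R, y]) limn (fun n : nat => (Num.min (v t) n.+1%:R)%:E))%E.
    apply: cvgI.
    - by move=> n; apply/measurable_EFinP/measurable_minr => //; exact: measurable_v.
    - by move=> n t _; rewrite lee_fin le_min v_ge0/=.
    - by move=> t _ m n mn; rewrite lee_fin le_min ge_min lexx/= ge_min ler_nat ltnS mn orbT.
  rewrite -(cvg_lim _ cvgI)//; apply: lime_le; first exact: (cvgP _ cvgI).
  by apply: nearW => n /=; apply: (monotone_truncated_FTC y0); rewrite ltr0Sn.
apply/eqP; rewrite eq_le le/=.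
pose f := v \_ `]0, y].
have int0 : mu.-integrable (`]0, y]%classic : set R) (EFin \o v).
  apply/integrableP; split; first by apply/measurable_EFinP; exact: measurable_v.
  under eq_integral do rewrite /= ger0_norm//.
  by rewrite (le_lt_trans le)// ltry.
have intf : mu.-integrable setT (EFin \o f).
  exact: integrable_restrict.
have f0 t : 0 <= f t.
  by rewrite /f patchE; case: ifPn.
have [E [t_ [mE E0 Nt Et ndF]]] := FTC_setup y0 intf f0.
set F := fun x : R => \int[mu]_(s in `]-oo, x]) f s in Et ndF.
have {}ndF a b : a <= b -> F a <= F b by exact: ndF.
have H : F 0 - W 0 <= F y - W y.
  apply: (@le_of_straddle_ae _ (fun x => F x - W x) 0 y E t_) => //.
  - move=> t e t0 ty tE e0.
    have [tt0 tN dF] := Et t t0 tE.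
    have e20 : 0 < e / 2 by rewrite divr_gt0.
    apply: straddle_imply (straddleI (is_derive_straddle 0 y (dW tt0 tN) e20)
      (is_derive_straddle 0 y dF e20)) => a b ab [].
    rewrite (_ : f t = w t).
      by rewrite !ler_norml => /andP[_ h1] /andP[h2 _]; lra.
    by rewrite /f patchE mem_set ?vE//= in_itv/= tt0.
  - move=> t t0 ty tN; have [tt0 tN'] := Nt t t0 tN.
    exists (w t + 1).
    apply: straddle_imply (is_derive_straddle 0 y (dW tt0 tN') ltr01) => a b ab.
    rewrite mul1r ler_norml => /andP[_ h1].
    have := ndF a b ab.
    by rewrite mulrDl mul1r; lra.
  - move=> t e t0 ty e0.
    have S := @continuous_straddle _ W t 0 y e (@cW t) e0.
    apply: (straddle_imply _ S) => a b ab.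
    rewrite ler_norml => /andP[_ h1].
    by have := ndF a b ab; lra.
have : W y - W 0 <= \int[mu]_(t in `]0%R, y]) v t.
  rewrite (_ : \int[mu]_(t in _) _ = F y - F 0); first lra.
  rewrite /F Rintegral_increment//; apply: eq_Rintegral => t ty.
  by rewrite /f patchE ty.
rewrite -lee_fin /Rintegral fineK//; exact: integrable_fin_num.
Unshelve. all: by end_near. Qed.

End monotone_FTC.

(** * Injectivity of the Laplace transform *)

Section real_integrable.
Context d (T : measurableType d) (R : realType).
Variables (m : {measure set T -> \bar R}) (D : set T) (mD : measurable D).

Lemma integrable_addr (f g : T -> R) : m.-integrable D (EFin \o f) ->
  m.-integrable D (EFin \o g) -> m.-integrable D (EFin \o (fun x => f x + g x)).
Proof.
move=> intf intg; rewrite (_ : _ \o _ = ((EFin \o f) \+ (EFin \o g))%E).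
  exact: integrableD.
by apply/funext => x; rewrite /= EFinD.
Qed.

Lemma integrable_mulr (c : R) (f : T -> R) : m.-integrable D (EFin \o f) ->
  m.-integrable D (EFin \o (fun x => c * f x)).
Proof.
move=> intf; rewrite (_ : _ \o _ = (fun x => c%:E * (EFin \o f) x)%E).
  exact: integrableZl.
by apply/funext => x; rewrite /= EFinM.
Qed.

Lemma integrable_subr (f g : T -> R) : m.-integrable D (EFin \o f) ->
  m.-integrable D (EFin \o g) -> m.-integrable D (EFin \o (fun x => f x - g x)).
Proof.
move=> intf intg; rewrite (_ : _ \o _ = ((EFin \o f) \- (EFin \o g))%E).
  exact: integrableB.
by apply/funext => x; rewrite /= EFinB.
Qed.

End real_integrable.

Lemma cvg_expRN_mulrn (R : realType) (c : R) : 0 < c ->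
  expR (- (n%:R * c)) @[n --> \oo] --> 0.
Proof.
move=> c0; under eq_fun do rewrite -mulrN expRM_natl.
apply: cvg_expr; rewrite ger0_norm ?expR_ge0//.
by rewrite -expR0 ltr_expR oppr_lt0.
Qed.

Section vanishing_exponential_moments.
Context (R : realType).
Local Notation mu := (@lebesgue_measure R).
Variable h : R -> R.
Hypothesis h0 : forall y, y <= 0 -> h y = 0.
Hypothesis int_h : forall k : nat,
  mu.-integrable setT (EFin \o (fun y => h y * expR (- (k%:R * y)))).
Hypothesis moment0 : forall k : nat,
  \int[mu]_y (h y * expR (- (k%:R * y))) = 0.

Let mh : measurable_fun setT h.
Proof.
have /integrableP[/measurable_EFinP + _] := int_h 0.
by under eq_fun do rewrite mul0r oppr0 expR0 mulr1.
Qed.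

Let int_h0 : mu.-integrable setT (EFin \o h).
Proof.
have := int_h 0.
by rewrite /comp; under eq_fun do rewrite mul0r oppr0 expR0 mulr1.
Qed.

(* exp (- z n x y) is a power series in exp (- n y), so its integral against h
   vanishes, and it tends to the indicator of y > x as n grows. *)
Let z (n : nat) (x y : R) : R := expR (- (n%:R * (y - x))).

Let int_partial (n m : nat) x :
  mu.-integrable setT (EFin \o (fun y => h y * series (exp_coeff (- z n x y)) m)) /\
  \int[mu]_y (h y * series (exp_coeff (- z n x y)) m) = 0.
Proof.
elim: m => [|m [IHi IH]].
  rewrite (_ : (fun y => _) = cst 0); last first.
    by apply/funext => y; rewrite /series/= big_geq// mulr0.
  split; first exact: integrable0.
  by rewrite /Rintegral integral0.
(* The m-th term of the exponential series at [- z n x y] is c times exp (- m n y), an exponential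
   of integer rate, so its integral against h is zero. *)
pose c : R := (-1) ^+ m * expR (m%:R * n%:R * x) / m`!%:R.
have E : (fun y => h y * series (exp_coeff (- z n x y)) m.+1) =
  (fun y => h y * series (exp_coeff (- z n x y)) m + c * (h y * expR (- ((m * n)%:R * y)))).
  apply/funext => y; rewrite seriesSr mulrDr; congr (_ + _).
  rewrite /exp_coeff /z /= exprNn -expRM_natl /c natrM.
  have -> : m%:R * - (n%:R * (y - x)) = m%:R * n%:R * x - m%:R * n%:R * y by ring.
  by rewrite expRD; ring.
have ic : mu.-integrable setT (EFin \o (fun y => c * (h y * expR (- ((m * n)%:R * y))))).
  exact: integrable_mulr.
rewrite E; split; first exact: integrable_addr.
by rewrite RintegralD// IH RintegralZl// moment0 mulr0 addr0.
Qed.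

Let int_h_gumbel (n : nat) x :
  mu.-integrable setT (EFin \o (fun y => h y * expR (- z n x y))) /\
  (\int[mu]_y (h y * expR (- z n x y))%:E = 0)%E.
Proof.
(* For y >= 0 the inner exponential is at most Z, so all partial sums are bounded by exp Z. For y <=
   0 this bound can fail, but there h vanishes. *)
pose Z : R := expR (n%:R * x).
have z0 y : 0 <= z n x y by rewrite expR_ge0.
have zZ y : 0 <= y -> z n x y <= Z.
  by move=> y0; rewrite ler_expR mulrBr opprB gerDl oppr_le0 mulr_ge0.
have mf m : measurable_fun setT (fun y => (h y * series (exp_coeff (- z n x y)) m)%:E).
  by have /integrableP[] := (int_partial n m x).1.
have mz : measurable_fun setT (fun y : R => (h y * expR (- z n x y))%:E).
  apply/measurable_EFinP; apply: measurable_funM => //.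
  apply: measurableT_comp => //; apply: measurableT_comp => //.
  apply: measurableT_comp => //; apply: measurableT_comp => //.
  by apply: measurable_funM => //; exact: measurable_funB.
have cvgf : {ae mu, forall y, setT y ->
    (h y * series (exp_coeff (- z n x y)) m)%:E @[m --> \oo] --> (h y * expR (- z n x y))%:E}.
  apply: aeW => y _; apply/cvg_EFin; first exact: nearW.
  by apply: cvgMr; exact: is_cvg_series_exp_coeff.
have intg : mu.-integrable setT (EFin \o (fun y => `|h y| * expR Z)).
  under eq_fun do rewrite mulrC.
  by apply: integrable_mulr => //; exact: integrable_norm.
have dom : {ae mu, forall y m, setT y ->
    (`|(h y * series (exp_coeff (- z n x y)) m)%:E| <= (`|h y| * expR Z)%:E)%E}.
  apply: aeW => y m _; rewrite lee_fin normrM.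
  have [y0|y0] := leP y 0; first by rewrite h0// normr0 !mul0r.
  apply: ler_wpM2l => //.
  rewrite /series/=; apply: le_trans (ler_norm_sum _ _ _) _.
  apply: (@le_trans _ _ (series (exp_coeff Z) m)).
    apply: ler_sum => i _; rewrite /exp_coeff normrM normrX normrN.
    rewrite (ger0_norm (z0 y)) [X in _ * X]ger0_norm//.
    by apply: ler_wpM2r => //; apply: lerXn2r; rewrite ?nnegrE ?expR_ge0//; apply: zZ; exact: ltW.
  apply: nondecreasing_cvgn_le; last exact: is_cvg_series_exp_coeff.
  apply: nondecreasing_series => i _ _; apply: exp_coeff_ge0; exact: expR_ge0.
have [int1 _ cvgI] := @dominated_convergence _ _ _ mu setT measurableT _ _ _ mf mz cvgf intg dom.
split => //.
apply: (cvg_unique _ cvgI) => //.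
rewrite (_ : [sequence _]_m = cst 0%E); first exact: cvg_cst.
apply/funext => m; have [i1 i2] := int_partial n m x.
by rewrite /= -[RHS]/(0%R%:E) -i2 /Rintegral fineK//; exact: integrable_fin_num.
Qed.

Lemma vanishing_moments_tail x : \int[mu]_(y in `]x, +oo[) h y = 0.
Proof.
have mz n : measurable_fun setT (fun y : R => (h y * expR (- z n x y))%:E).
  by have /integrableP[] := (int_h_gumbel n x).1.
have mt : measurable_fun setT (fun y : R => (h y * \1_`]x, +oo[ y)%:E).
  by apply/measurable_EFinP; apply: measurable_funM.
have cvgf : {ae mu, forall y, setT y ->
    (h y * expR (- z n x y))%:E @[n --> \oo] --> (h y * \1_`]x, +oo[ y)%:E}.
  (* At y = x the kernel equals exp (- 1) for every n, so this one point is left out. *)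
  exists [set x]; split => //; first exact: lebesgue_measure_set1.
  move=> y /=; apply: contra_notP => yx _.
  apply/cvg_EFin; first exact: nearW.
  apply: cvgMr; rewrite indicE.
  have [yltx|yltx|//] := ltgtP y x.
    rewrite memNset/=; last by rewrite in_itv/= andbT; apply/negP; rewrite -leNgt ltW.
    have c0 : 0 < x - y by rewrite subr_gt0.
    apply: (@squeeze_cvgr _ _ _ _ (cst 0) (fun n : nat => expR (- (n%:R * (x - y))))).
    - apply: nearW => n; rewrite expR_ge0/= ler_expR lerN2 /z.
      rewrite -mulrN opprB; apply: le_trans (expR_ge1Dx _).
      by rewrite lerDr.
    - exact: cvg_cst.
    - exact: cvg_expRN_mulrn.
  rewrite mem_set/=; last by rewrite in_itv/= andbT.
  rewrite -(@expR0 R) -oppr0.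
  apply: continuous_cvg; first exact: continuous_expR.
  by apply: cvgN; apply: cvg_expRN_mulrn; rewrite subr_gt0.
have dom : {ae mu, forall y n, setT y ->
    (`|(h y * expR (- z n x y))%:E| <= (`|h y|)%:E)%E}.
  apply: aeW => y n _; rewrite lee_fin normrM.
  by rewrite ler_piMr// ger0_norm ?expR_ge0// -expR0 ler_expR oppr_le0 expR_ge0.
have intg : mu.-integrable setT (EFin \o (fun y => `|h y|)) by exact: integrable_norm.
have [int1 _ cvgI] := @dominated_convergence _ _ _ mu setT measurableT _ _ _ mz mt cvgf intg dom.
rewrite Rintegral_mkcond /Rintegral.
rewrite (_ : (fun y => _) = (fun y : R => (h y * \1_`]x, +oo[ y)%:E)); last first.
  by apply/funext => y; rewrite patchE indicE; case: ifPn => _; rewrite ?mulr1 ?mulr0.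
rewrite -[RHS]/(fine 0%E); congr fine.
apply: (cvg_unique _ cvgI) => //.
rewrite (_ : [sequence _]_m = cst 0%E); first exact: cvg_cst.
by apply/funext => n; exact: (int_h_gumbel n x).2.
Qed.

(** The total integral and all tail integrals of h vanish, so its primitive is constantly 0, and the
    derivative of that primitive is h almost everywhere. *)
Lemma vanishing_moments_ae : exists E : set R, [/\ measurable E, mu E = 0%E &
  forall t, ~ E t -> h t = 0].
Proof.
have [E [mE E0 dF]] := FTC_null_set int_h0.
exists E; split => // t Et.
have [_ <-] := dF t Et.
rewrite (_ : (fun x => _) = cst 0) ?derive_cst//.
apply/funext => x.
have := @Rintegral_itvB R h -oo%O +oo%O x; rewrite vanishing_moments_tail.
have := moment0 0; under eq_Rintegral do rewrite mul0r oppr0 expR0 mulr1.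
rewrite -set_itvNyy => ->; rewrite set_itvNyy => /(_ int_h0 isT isT).
by move/eqP; rewrite sub0r oppr_eq0 => /eqP.
Qed.

End vanishing_exponential_moments.

Section laplace_injectivity.
Context (R : realType).
Local Notation mu := (@lebesgue_measure R).
Implicit Types (f g : R -> \bar R) (s : R).

Definition lebesgue_null (E : set R) := measurable E /\ mu E = 0%E.

Lemma countable_lebesgue_null (A : set R) : countable A -> lebesgue_null A.
Proof.
by move=> cA; split; [exact: countable_measurableR|exact: countable_lebesgue_measure0].
Qed.

Lemma eq_laplace_ae f g (E : set R) s : half_line f -> half_line g ->
  lebesgue_null E -> (forall t, ~ E t -> f t = g t) -> laplace f s = laplace g s.
Proof.
move=> [mf f0 _] [mg g0 _] [mE E0] fg.
apply: ge0_ae_eq_integral => //.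
- exact: measurable_expRM_mul.
- exact: measurable_expRM_mul.
- by move=> x _; rewrite mule_ge0 ?lee_fin ?expR_ge0.
- by move=> x _; rewrite mule_ge0 ?lee_fin ?expR_ge0.
exists E; split => // t /= H; apply: contrapT => Et; apply: H => _.
by rewrite fg.
Qed.

Definition finite_part f (x : R) : R := fine (f x).

Lemma half_line_finite_part f : half_line f -> half_line (EFin \o finite_part f).
Proof.
move=> [mf f0 fz]; split.
(* [fine] sends +oo to 0, so the finite part is f restricted to the set where it is finite. *)
- rewrite (_ : _ \o _ = f \_ [set x | (f x < +oo)%E]).
    apply/(measurable_restrictT _ _).1; last exact: measurable_funTS.
    rewrite -[X in measurable X]setTI.
    by apply: emeasurable_fun_infty_o.
  apply/funext => x; rewrite /finite_part/= patchE; case: ifPn => [|].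
    by rewrite inE/= => fx; rewrite fineK// ge0_fin_numE.
  rewrite notin_setE/= => /negP; rewrite -leNgt leye_eq => /eqP ->.
  by [].
- by move=> x; rewrite lee_fin fine_ge0.
- by move=> x x0; rewrite /finite_part/= fz.
Qed.

(** The exponential weight is positive, so an infinite value of f on a set of positive measure would
    make the transform infinite. *)
Lemma finite_part_ae f s : half_line f -> (laplace f s < +oo)%E ->
  exists2 E, lebesgue_null E & forall t, ~ E t -> f t = (finite_part f t)%:E.
Proof.
move=> [mf f0 fz] Lf.
have int_f : mu.-integrable setT (fun x => (expR (- s * x))%:E * f x)%E.
  apply/integrableP; split; first exact: measurable_expRM_mul.
  under eq_integral do rewrite gee0_abs ?mule_ge0 ?lee_fin ?expR_ge0//.
  exact: Lf.
have [E [mE E0 sE]] := integrable_ae measurableT int_f.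
exists E => // t Et; rewrite /finite_part fineK//.
have : ((expR (- s * t))%:E * f t)%E \is a fin_num.
  by apply: contrapT => h; apply: Et; apply: sE => /= /(_ I).
rewrite ge0_fin_numE ?mule_ge0 ?lee_fin ?expR_ge0// ge0_fin_numE//.
case: (f t) (f0 t) => [r _ _|_|//]; first by rewrite ltry.
by rewrite gt0_muley ?lte_fin ?expR_gt0// ltxx.
Qed.

Lemma integrable_laplace_real (f : R -> R) s : half_line (EFin \o f) ->
  (laplace (EFin \o f) s < +oo)%E ->
  mu.-integrable setT (EFin \o (fun y => expR (- s * y) * f y)).
Proof.
move=> [mf f0 fz] Lf; apply/integrableP; split.
  apply/measurable_EFinP; apply: measurable_funM; last exact/measurable_EFinP.
  by apply/measurable_EFinP; exact: measurable_expRM.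
rewrite (_ : (fun x => _) = (fun x => (expR (- s * x))%:E * (EFin \o f) x)%E)//.
apply/funext => x; rewrite /= ger0_norm ?EFinM// mulr_ge0 ?expR_ge0//.
by rewrite -lee_fin; exact: f0.
Qed.

Lemma laplace_real_inj (f g : R -> R) s0 :
  half_line (EFin \o f) -> half_line (EFin \o g) ->
  (forall s, s0 <= s -> laplace (EFin \o f) s = laplace (EFin \o g) s) ->
  (forall s, s0 <= s -> (laplace (EFin \o f) s < +oo)%E) ->
  exists2 E, lebesgue_null E & forall t, ~ E t -> f t = g t.
Proof.
move=> hf hg fg Lf.
have s0k (k : nat) : s0 <= s0 + k%:R by rewrite lerDl.
(* The k-th exponential moment of h is the difference of the two transforms at s0 + k. *)
pose h y := expR (- s0 * y) * (f y - g y).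
have hE k : (fun y => h y * expR (- (k%:R * y))) =
    (fun y => expR (- (s0 + k%:R) * y) * f y - expR (- (s0 + k%:R) * y) * g y).
  apply/funext => y; rewrite /h mulrAC -expRD mulrBr.
  by have -> : - s0 * y + - (k%:R * y) = - (s0 + k%:R) * y by ring.
have intf (k : nat) := integrable_laplace_real hf (Lf _ (s0k k)).
have intg (k : nat) : mu.-integrable setT (EFin \o (fun y => expR (- (s0 + k%:R) * y) * g y)).
  by apply: integrable_laplace_real => //; rewrite -fg// Lf.
have h0 y : y <= 0 -> h y = 0.
  case: hf hg => _ _ fz [_ _ gz] y0; rewrite /h.
  have [-> ->] : f y = 0 /\ g y = 0 by split; apply: EFin_inj; [exact: fz|exact: gz].
  by rewrite subrr mulr0.
have int_h k : mu.-integrable setT (EFin \o (fun y => h y * expR (- (k%:R * y)))).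
  by rewrite hE; apply: integrable_subr.
have mom k : \int[mu]_y (h y * expR (- (k%:R * y))) = 0.
  rewrite hE RintegralB//; apply/eqP; rewrite subr_eq0; apply/eqP.
  rewrite /Rintegral; congr fine.
  have LE (u : R -> R) : (\int[mu]_y (expR (- (s0 + k%:R) * y) * u y)%:E =
      laplace (EFin \o u) (s0 + k%:R))%E.
    by apply: eq_integral => y _; rewrite EFinM.
  by rewrite !LE fg.
have [E [mE E0 hz]] := vanishing_moments_ae h0 int_h mom.
exists E => // t /hz/eqP; rewrite mulf_eq0 gt_eqF ?expR_gt0//= subr_eq0.
by move/eqP.
Qed.

(** Finite and equal transforms from s0 on force f = g almost everywhere, hence equal transforms at
    every s, with no assumption of finiteness there. *)
Theorem laplace_inj f g s0 : half_line f -> half_line g ->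
  (forall s, s0 <= s -> laplace f s = laplace g s) ->
  (forall s, s0 <= s -> (laplace f s < +oo)%E) ->
  forall s, laplace f s = laplace g s.
Proof.
move=> hf hg fg Lf s.
have Lg t : s0 <= t -> (laplace g t < +oo)%E by move=> st; rewrite -fg// Lf.
have [Ef nEf fE] := finite_part_ae hf (Lf _ (lexx s0)).
have [Eg nEg gE] := finite_part_ae hg (Lg _ (lexx s0)).
have Lff t := eq_laplace_ae t hf (half_line_finite_part hf) nEf fE.
have Lgg t := eq_laplace_ae t hg (half_line_finite_part hg) nEg gE.
have [] := @laplace_real_inj (finite_part f) (finite_part g) s0.
- exact: half_line_finite_part.
- exact: half_line_finite_part.
- by move=> t st; rewrite -Lff -Lgg fg.
- by move=> t st; rewrite -Lff Lf.
move=> E nE EE; rewrite Lff Lgg.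
apply: (eq_laplace_ae s (half_line_finite_part hf) (half_line_finite_part hg) nE).
by move=> t /EE /= ->.
Qed.

End laplace_injectivity.

(** * Derivatives of monotone functions on the half line *)

Section atoms.
Context d (T : measurableType d) (R : realType).

Lemma countable_atoms (m : {finite_measure set T -> \bar R}) :
  (forall t : T, measurable [set t]) -> countable [set t : T | m [set t] != 0%E].
Proof.
move=> m1.
have -> : [set t : T | m [set t] != 0%E] =
    \bigcup_n [set t | (n.+1%:R^-1%:E <= m [set t])%E].
  apply/seteqP; split => [t /= mt|t [n _ /=]]; last first.
    by apply: contraTneq => ->; rewrite -ltNge lte_fin.
  have mt0 : (0 < m [set t])%E by rewrite lt_neqAle eq_sym mt measure_ge0.
  have mfin : m [set t] \is a fin_num by exact: fin_num_measure.
  have : 0 < fine (m [set t]) by rewrite fine_gt0// mt0 ltey_eq mfin.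
  move=> mt1; have [n _ nP] := near_infty_natSinv_lt (PosNum mt1).
  exists n => //=.
  by rewrite -(fineK mfin) lee_fin ltW//; exact: (nP n (leqnn n)).
apply: bigcup_countable => // n _; apply: finite_set_countable.
apply: contrapT => infA.
have mT : m setT \is a fin_num by exact: fin_num_measure.
(* More than m(T) (n + 1) points, so that k atoms of mass at least 1 / (n + 1) would exceed the
   total mass. *)
pose k := (`|Num.ceil (fine (m setT) * n.+1%:R)|%N).+1.
have [F FA kF] := infinite_set_fset k infA.
have mF : m (\big[setU/set0]_(i <- finmap.enum_fset F) [set i]) = (\sum_(i <- finmap.enum_fset F) m [set i])%E.
  by apply: measure_fbigsetU => // i j _ _ [x [/= -> ->]].
have : (\sum_(i <- finmap.enum_fset F) (n.+1%:R^-1 : R)%:E <= m setT)%E.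
  apply: (@le_trans _ _ (\sum_(i <- finmap.enum_fset F) m [set i])%E).
    rewrite big_seq [leRHS]big_seq; apply: lee_sum => i iF; exact: FA.
  rewrite -mF; apply: le_measure; rewrite ?inE//.
  by apply: bigsetU_measurable.
rewrite sumEFin big_const_seq count_predT iter_addr_0 -(fineK mT) lee_fin.
apply/negP; rewrite -ltNge -[X in _ < X]mulr_natr -(@ltr_pM2r _ n.+1%:R)// mulrAC mulVf// mul1r.
apply: le_lt_trans (ceil_ge _) _; apply: le_lt_trans (ler_norm _) _.
by rewrite -intr_norm -natr_absz ltr_nat.
Qed.

End atoms.

Section monotone_laplace.
Context (R : realType).
Local Notation mu := (@lebesgue_measure R).
Implicit Types (W w : R -> R) (N : set R) (s x y : R).

(** The map x -> max x 0 does not increase distances, so a modulus of continuity on the half line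
    serves on the whole line. *)
Lemma continuous_max0 W : {within `[0, +oo[, continuous W} ->
  continuous (fun x => W (Num.max x 0)).
Proof.
move=> cW x; apply/cvgrPdist_le => e e0.
have x0 : `[0, +oo[%classic (Num.max x 0).
  by rewrite /= in_itv/= andbT le_max lexx orbT.
have /cvgrPdist_le/(_ e e0) := (subspace_continuousP _ _).1 cW _ x0.
move=> /nbhs_ballP[d /= d0 dP]; apply/nbhs_ballP; exists d => //= y xy.
apply: dP => /=; last by rewrite in_itv/= andbT le_max lexx orbT.
rewrite /ball/= in xy *; apply: le_lt_trans xy.
have [x0'|x0'] := leP x 0; have [y0|y0] := leP y 0; rewrite ?subrr ?normr0//.
- rewrite sub0r normrN gtr0_norm// distrC ger0_norm ?lerDl ?oppr_ge0//.
  by rewrite subr_ge0 ltW// (le_lt_trans x0').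
- rewrite subr0 gtr0_norm// ger0_norm ?lerDl ?oppr_ge0//.
  by rewrite subr_ge0 (le_trans y0)// ltW.
Qed.

(* The values of w at the exceptional points are arbitrary, hence the maximum. *)
Definition positive_part_on_half_line w : R -> \bar R :=
  (fun t => (Num.max (w t) 0)%:E) \_ `]0, +oo[.

Variables (W w : R -> R) (N : set R).
Hypothesis ndW : forall x y, 0 <= x -> x <= y -> W x <= W y.
Hypothesis cW : {within `[0, +oo[, continuous W}.
Hypothesis cN : countable N.
Hypothesis dW : forall t, 0 < t -> ~ N t -> is_derive t 1 W (w t).

(** W is constrained only on x >= 0; freezing it at W 0 on the left gives the globally nondecreasing
    continuous function that [monotone_FTC] asks for. *)
Let W' x := W (Num.max x 0).

Let W'E x : 0 <= x -> W' x = W x.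
Proof. by move=> x0; rewrite /W' max_l. Qed.

Let ndW' : {homo W' : a b / a <= b}.
Proof.
move=> a b ab; apply: ndW; first by rewrite le_max lexx orbT.
by rewrite ge_max !le_max ab lexx /= orbT.
Qed.

Let cW' : continuous W'. Proof. exact: continuous_max0. Qed.

Let dW' t : 0 < t -> ~ N t -> is_derive t 1 W' (w t).
Proof.
move=> t0 Nt; apply: near_eq_is_derive (dW t0 Nt).
near=> z; apply/esym/W'E/ltW; near: z; exact: lt_nbhsr.
Unshelve. all: by end_near. Qed.

Lemma half_line_derivative_measurable : measurable_fun (`]0, +oo[%classic : set R) w.
Proof. exact: (monotone_derivative_measurable ndW' cW' cN dW'). Qed.

Lemma half_line_derivative_ge0 t : 0 < t -> ~ N t -> 0 <= w t.
Proof. by move=> t0 Nt; exact: (monotone_derivative_ge0 ndW' dW' t0 Nt). Qed.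

Lemma half_line_positive_part : half_line (positive_part_on_half_line w).
Proof.
apply: half_line_mkcond => [|x x0]; last by rewrite lee_fin le_max lexx orbT.
apply/measurable_EFinP; apply: measurable_maxr => //.
exact: half_line_derivative_measurable.
Qed.

Lemma convolution_heaviside_derivative y : 0 < y ->
  (convolution (@heaviside R) (positive_part_on_half_line w) y = (W y - W 0)%:E)%E.
Proof.
move=> y0.
rewrite -(W'E (ltW y0)) -(W'E (lexx 0)) -(monotone_FTC ndW' cW' cN dW' (ltW y0)).
rewrite -[RHS]integral_itv_bndo_bndc; last first.
  apply/measurable_EFinP; apply: measurable_maxr => //.
  apply: measurable_funS half_line_derivative_measurable => //.
  by apply: subset_itvl.
rewrite [RHS]integral_mkcond; apply: eq_integral => t _.
rewrite /positive_part_on_half_line /heaviside !patchE indicE.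
have -> : (y - t \in `]0, +oo[%classic) = (t < y).
  by apply/idP/idP; rewrite inE/= in_itv/= andbT subr_gt0.
have -> : (t \in `]0, +oo[%classic) = (0 < t).
  by apply/idP/idP; rewrite inE/= in_itv/= andbT.
have -> : (t \in `]0, y[%classic) = (0 < t) && (t < y).
  by apply/idP/idP; rewrite inE/= in_itv/=.
case: (0 < t) => /=; last by rewrite mule0.
by case: (t < y); rewrite /= ?mul1e ?mul0e.
Qed.

(** On the half line W is the convolution of [heaviside] with its derivative plus W 0 times
    [heaviside]. The additive form stays valid when the transforms are infinite. *)
Lemma laplace_derivative s : 0 <= W 0 -> 0 < s ->
  shifted_laplace 0 W s =
  ((s^-1)%:E * laplace (positive_part_on_half_line w) s + (W 0 * s^-1)%:E)%E.
Proof.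
move=> W0 s0.
have hH := @half_line_heaviside R.
have hc := half_line_convolution hH half_line_positive_part.
rewrite -(laplace_heaviside s0) -laplace_convolution//; last exact: half_line_positive_part.
rewrite EFinM -(laplace_heaviside s0) -laplaceZ// -laplaceD//; last exact: half_lineZ.
rewrite laplace_half_line; last by apply: half_lineD => //; exact: half_lineZ.
apply: eq_integral => y; rewrite inE/= in_itv/= andbT => y0.
rewrite subr0 EFinM convolution_heaviside_derivative//.
rewrite /heaviside indicE mem_set/=; last by rewrite in_itv/= andbT.
by rewrite -EFinM -EFinD mulr1 subrK.
Qed.

End monotone_laplace.

(** * Laplace transform of the Volterra equation *)

Section volterra_laplace.
Context (R : realType).
Local Notation mu := (@lebesgue_measure R).
Local Open Scope ereal_scope.

Definition half_line_fun (f : R -> R) : R -> \bar R := (EFin \o f) \_ `]0%R, +oo[.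

Lemma half_line_funE (f : R -> R) x : half_line_fun f x = if (0 < x)%R then (f x)%:E else 0.
Proof.
rewrite /half_line_fun patchE.
have -> // : (x \in `]0%R, +oo[%classic) = (0 < x)%R.
by apply/idP/idP; rewrite inE/= in_itv/= andbT.
Qed.

Lemma half_line_half_line_fun (f : R -> R) :
  measurable_fun (`]0%R, +oo[%classic : set R) f -> (forall x, (0 < x)%R -> (0 <= f x)%R) ->
  half_line (half_line_fun f).
Proof.
move=> mf f0; apply: half_line_mkcond; first exact/measurable_EFinP.
by move=> x x0; rewrite lee_fin f0.
Qed.

Lemma integral_shift_half_line (a : R) (F : R -> \bar R) :
  (forall x, 0 <= F x) -> measurable_fun setT F ->
  \int[mu]_(x in `]a, +oo[) F (x - a)%R = \int[mu]_(x in `]0%R, +oo[) F x.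
Proof.
move=> F0 mF; rewrite integral_mkcond [RHS]integral_mkcond.
rewrite -[RHS](@integral_translation _ _ (- a)%R).
- apply: eq_integral => x _; rewrite !patchE.
  have -> // : (x \in `]a, +oo[%classic) = ((x - a)%R \in `]0%R, +oo[%classic).
  by apply/idP/idP; rewrite !inE/= !in_itv/= !andbT subr_gt0.
- by apply/(measurable_restrictT _ _).1 => //; exact: measurable_funTS.
- by move=> x; rewrite patchE; case: ifPn.
Qed.

Variables (a : R) (wa : R -> R).
Hypothesis wa_ge0 : forall x, (a < x)%R -> (0 <= wa x)%R.
Hypothesis wa_meas : measurable_fun (`]a, +oo[%classic : set R) wa.

Let u := half_line_fun (fun y => wa (a + y)%R).
Let m := half_line_fun (fun y => y * wa (a + y)%R)%R.

Lemma measurable_shift_half_line :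
  measurable_fun (`]0%R, +oo[%classic : set R) (fun y => wa (a + y)%R).
Proof.
apply: (@measurable_comp _ _ _ _ _ _ (`]a, +oo[%classic : set R)) => //.
  by move=> x [y /=]; rewrite !in_itv/= !andbT => y0 <-; rewrite ltrDl.
exact: measurable_funD.
Qed.

Lemma half_line_shift : half_line u.
Proof.
apply: half_line_half_line_fun; first exact: measurable_shift_half_line.
by move=> x x0; apply: wa_ge0; rewrite ltrDl.
Qed.

Lemma half_line_shiftM : half_line m.
Proof.
apply: half_line_half_line_fun.
  by apply: measurable_funM => //; exact: measurable_shift_half_line.
by move=> x x0; apply: mulr_ge0; [exact: ltW|apply: wa_ge0; rewrite ltrDl].
Qed.

Lemma shifted_laplaceE s : shifted_laplace a wa s = laplace u s.
Proof.
have [mu_ u0 _] := half_line_shift.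
rewrite laplace_half_line; last exact: half_line_shift.
rewrite -(@integral_shift_half_line a).
- apply: eq_integral => x; rewrite inE/= in_itv/= andbT => ax.
  by rewrite /u half_line_funE subr_gt0 ax -EFinM subrKC.
- by move=> x; rewrite mule_ge0 ?lee_fin ?expR_ge0.
- exact: measurable_expRM_mul.
Qed.

Variables (alpha0 c r : R) (wq : R -> R) (N : set R).
Hypothesis c0 : (0 < c)%R.
Hypothesis r0 : (0 < r)%R.
Hypothesis cN : countable N.
Hypothesis wq_ge0 : forall t, (0 < t)%R -> ~ N t -> (0 <= wq t)%R.
Hypothesis wq_meas : measurable_fun (`]0%R, +oo[%classic : set R) wq.
Hypothesis volterra : volterra_equation alpha0 c r a wq wa.

Let v := positive_part_on_half_line wq.

Let vE (t : R) : (0 < t)%R -> ~ N t -> v t = (wq t)%:E.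
Proof.
move=> t0 Nt; rewrite /v /positive_part_on_half_line patchE mem_set/=; last by rewrite in_itv/= t0.
by rewrite max_l// wq_ge0.
Qed.

Let v_half : half_line v.
Proof.
apply: half_line_mkcond => [|x x0]; last by rewrite lee_fin le_max lexx orbT.
by apply/measurable_EFinP; apply: measurable_maxr.
Qed.

(** The drift difference is - r (z - a); its factor z - a is the weight that turns the shifted [wa]
    into [m]. *)
Lemma volterra_integral (y : R) : (0 < y)%R ->
  \int[mu]_(z in `]a, (a + y)%R[)
    (wq (a + y - z) * wa z * (drift c r a a - drift c r a z))%:E =
  - (r%:E * convolution v m y).
Proof.
move=> y0.
have [mv v0 vz] := v_half; have [mm m0 mz] := half_line_shiftM.
pose g z := r%:E * (v (a + y - z)%R * m (z - a)%R).
have mg : measurable_fun setT g.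
  apply: measurable_funeM; apply: emeasurable_funM.
    by apply: (measurableT_comp mv); apply: measurable_funB.
  by apply: (measurableT_comp mm); apply: measurable_funB.
have g0 z : 0 <= g z by rewrite /g !mule_ge0// lee_fin ltW.
(* [wq] and its positive part can differ only where a + y - z lies in N, which is a countable set of
   z. *)
transitivity (\int[mu]_(z in `]a, (a + y)%R[) (- g z)).
  apply: ae_eq_integral => //.
  - apply/measurable_EFinP; apply: measurable_funM.
      apply: measurable_funM; last first.
        by apply: measurable_funS wa_meas => //; exact: subset_itvl.
      apply: (@measurable_comp _ _ _ _ _ _ (`]0%R, +oo[%classic : set R)) => //.
        by move=> x [z /=]; rewrite !in_itv/= !andbT => /andP[_ h] <-; rewrite subr_gt0.
      exact: measurable_funB.
    apply: measurable_funB => //; apply: measurable_funD => //.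
    by apply: measurable_funM => //; exact: measurable_funB.
  - by apply: measurable_funTS; exact: measurableT_comp.
  have [mE E0] : lebesgue_null [set z | N (a + y - z)%R].
    apply: countable_lebesgue_null.
    rewrite (_ : [set z | _] = (fun t => a + y - t)%R @` N).
      by apply: sub_countable cN; exact: card_image_le.
    apply/seteqP; split => [z Nz|_ [t Nt <-] /=]; last by rewrite subKr.
    by exists (a + y - z)%R => //; rewrite subKr.
  exists [set z | N (a + y - z)%R]; split => // z /=; apply: contra_notP => Nz.
  rewrite in_itv/= => /andP[az zay].
  rewrite /g vE//; last by rewrite subr_gt0.
  rewrite /m half_line_funE subr_gt0 az subrKC -!EFinM -EFinN; congr EFin.
  by rewrite /drift subrr mulr0 addr0; ring.
rewrite integral_ge0N; last by move=> z _.
congr (- _); rewrite /convolution -ge0_integralZl//; last 3 first.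
- apply: emeasurable_funM => //.
  by apply: (measurableT_comp mv); apply: measurable_funB.
- by move=> z _; rewrite mule_ge0.
- by rewrite lee_fin ltW.
rewrite -[RHS](@integral_translation _ _ (- a)%R).
- rewrite integral_mkcond; apply: eq_integral => z _; rewrite patchE /g.
  have e : (y - (z - a) = a + y - z)%R by ring.
  case: ifPn => [_|]; first by rewrite e.
  rewrite notin_setE/= in_itv/= => /negP; rewrite negb_and -!leNgt => /orP[za|yz].
    by rewrite mz ?mule0// subr_le0.
  by rewrite e vz ?mul0e ?mule0// subr_le0.
- apply: measurable_funeM; apply: emeasurable_funM => //.
  by apply: (measurableT_comp mv); apply: measurable_funB.
- by move=> z; rewrite !mule_ge0// lee_fin ltW.
Qed.

Lemma volterra_ae (W0 : R) : W0 = (if 0 < alpha0 then 0 else c^-1)%R ->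
  forall t, ~ N t -> v t = u t + ((W0 * r)%:E * m t + r%:E * convolution v m t).
Proof.
move=> W0E t Nt.
have hc := half_line_convolution v_half half_line_shiftM.
have [_ v0 vz] := v_half; have [_ m0 mz] := half_line_shiftM.
have [_ u0 uz] := half_line_shift; have [_ k0 kz] := hc.
have [t0|t0] := leP t 0%R.
  by rewrite vz// uz// mz// kz// !mule0 !adde0.
have /volterra : (a < a + t)%R by rewrite ltrDl.
rewrite volterra_integral// (_ : a + t - a = t)%R; last by ring.
rewrite vE// /u half_line_funE t0.
(* With c(a + t) / c(a) = 1 + r t / c and W0 equal to 0 or 1 / c, both cases of the equation take
   the same form. *)
have -> : (if (0 < alpha0)%R then wa (a + t)%R
     else wa (a + t) * (drift c r a (a + t) / drift c r a a))%R =
     (wa (a + t) + W0 * r * (t * wa (a + t)))%R.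
  rewrite W0E /drift subrr mulr0 !addr0 (_ : a + t - a = t)%R; last by ring.
  by case: ifPn => _; [rewrite !mul0r addr0|field; rewrite gt_eqF].
rewrite /m half_line_funE t0 -/m.
move: (k0 t); case: (convolution v m t) => [k|_|//].
  move=> _; rewrite -!EFinM -EFinN -!EFinD => -[h]; congr EFin.
  by rewrite addrA -h subrK.
(* An infinite convolution would make the left side of the Volterra equation -oo, while its right
   side is real. *)
by rewrite gt0_muley ?lte_fin.
Qed.

Lemma laplace_volterra (W0 : R) s : W0 = (if 0 < alpha0 then 0 else c^-1)%R ->
  laplace v s = laplace u s + ((W0 * r)%:E * laplace m s + r%:E * (laplace v s * laplace m s)).
Proof.
move=> W0E.
have W00 : (0 <= W0 * r)%R.
  rewrite W0E; apply: mulr_ge0; last exact: ltW.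
  by case: ifPn => // _; rewrite invr_ge0 ltW.
have hc := half_line_convolution v_half half_line_shiftM.
have hm := half_lineZ W00 half_line_shiftM.
have hk := half_lineZ (ltW r0) hc.
rewrite [LHS](@eq_laplace_ae _ _ _ N s v_half _ (countable_lebesgue_null cN) (volterra_ae W0E)).
  rewrite laplaceD//; [|exact: half_line_shift|exact: half_lineD].
  rewrite laplaceD// (laplaceZ _ W00 half_line_shiftM) (laplaceZ _ (ltW r0) hc).
  by rewrite laplace_convolution//; exact: half_line_shiftM.
by apply: half_lineD; [exact: half_line_shift|exact: half_lineD].
Qed.

End volterra_laplace.

(** * Differentiation of the Laplace transform *)

Section laplace_derivative.
Context (R : realType).
Local Notation mu := (@lebesgue_measure R).
Implicit Types (s t x y k : R).
Variable f : R -> R.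
Hypothesis hf : half_line (EFin \o f).
Hypothesis Lf : forall s, 0 < s -> (laplace (EFin \o f) s < +oo)%E.

Let f_ge0 x : 0 <= f x.
Proof. by case: hf => _ f0 _; rewrite -lee_fin; exact: f0. Qed.

Let f_eq0 x : x <= 0 -> f x = 0.
Proof. by move=> x0; case: hf => _ _ fz; apply: EFin_inj; exact: fz. Qed.

Let intf s : 0 < s -> mu.-integrable setT (EFin \o (fun y => expR (- s * y) * f y)).
Proof. by move=> s0; exact: integrable_laplace_real hf (Lf s0). Qed.

(** Half of the exponent pays for the factor y, since k y <= exp (k y). *)
Let mulr_expRN (k y : R) : 0 < k -> y * expR (- (2 * k) * y) <= k^-1 * expR (- k * y).
Proof.
move=> k0; have -> : - (2 * k) * y = - k * y + - (k * y) by ring.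
rewrite expRD [X in y * X]mulrC mulrA; apply: ler_wpM2r; first exact: expR_ge0.
rewrite expRN -ler_pdivlMr ?invr_gt0 ?expR_gt0// invrK ler_pdivlMl//.
by apply: le_trans (expR_ge1Dx _); rewrite lerDr.
Qed.

Lemma half_line_mulid : half_line (EFin \o (fun y => y * f y)).
Proof.
have [mf _ _] := hf; split.
- by apply/measurable_EFinP; apply: measurable_funM => //; exact/measurable_EFinP.
- move=> x; rewrite lee_fin; have [x0|x0] := leP x 0; first by rewrite f_eq0// mulr0.
  by rewrite mulr_ge0// ltW.
- by move=> x x0; rewrite /= f_eq0// mulr0.
Qed.

Lemma laplace_mulid_lty s : 0 < s -> (laplace (EFin \o (fun y : R => y * f y)%R) s < +oo)%E.
Proof.
move=> s0; pose k := s / 2; have k0 : 0 < k by rewrite divr_gt0.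
have Lk := Lf k0.
have -> : s = 2 * k by rewrite /k; field.
apply: (@le_lt_trans _ _ (laplace (fun y => (k^-1)%:E * (EFin \o f) y)%E k)).
  apply: ge0_le_integral => //.
  - have [_ h _] := half_line_mulid.
    by move=> y _; rewrite mule_ge0 ?lee_fin ?expR_ge0//; exact: h.
  - by apply: measurable_expRM_mul; have [] := half_line_mulid.
  - by apply: measurable_expRM_mul; apply: measurable_funeM; have [] := hf.
  - move=> y _; rewrite /= -!EFinM lee_fin mulrA [X in X <= _]mulrA.
    rewrite [expR _ * y]mulrC [expR _ * k^-1]mulrC; apply: ler_wpM2r => //.
    exact: mulr_expRN.
rewrite laplaceZ ?invr_ge0 ?(ltW k0)//.
by rewrite lte_mul_pinfty// lee_fin invr_ge0 ltW.
Qed.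

Lemma fine_laplaceE (g : R -> R) s :
  fine (laplace (EFin \o g) s) = \int[mu]_y (expR (- s * y) * g y).
Proof. by rewrite /Rintegral; congr fine; apply: eq_integral => y _; rewrite EFinM. Qed.

Lemma is_derive_laplace s : 0 < s ->
  is_derive s 1 (fun t => fine (laplace (EFin \o f) t))
    (- fine (laplace (EFin \o (fun y => y * f y)) s)).
Proof.
(* For t between 2 k = s / 2 and 2 s, the weight y exp (- t y) is at most y exp (- 2 k y) for y > 0,
   hence at most exp (- k y) / k; this majorant is integrable against f because the transform is
   finite at k. *)
move=> s0; pose k := s / 4; have k0 : 0 < k by rewrite divr_gt0.
pose F (t y : R) := expR (- t * y) * f y.
have -> : (fun t => fine (laplace (EFin \o f) t)) = (fun t => \int[mu]_y F t y).
  by apply/funext => t; rewrite fine_laplaceE.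
have dF t y : is_derive t 1 (F ^~ y) (- (expR (- t * y) * (y * f y))).
  have d1 : is_derive t 1 (fun t : R => - t * y) (- y).
    rewrite (_ : (fun _ => _) = (- y) *: (@id R)).
      by apply: is_derive_eq; rewrite /GRing.scale/= mulr1.
    by apply/funext => z; rewrite mulNr mulrC -mulNr.
  have d2 := @is_derive1_comp _ expR _ t _ _ (is_derive_expR _) d1.
  rewrite (_ : F ^~ y = f y *: (expR \o (fun t : R => - t * y))).
    by apply: is_derive_eq; rewrite /GRing.scale/=; ring.
  by apply/funext => z; rewrite /F /GRing.scale/= mulrC.
have sI : `](2 * k), (2 * s)[%classic s.
  by rewrite /= in_itv/= /k; apply/andP; split; lra.
have tpos t : `](2 * k), (2 * s)[%classic t -> 2 * k < t.
  by rewrite /= in_itv/= => /andP[].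
have iF t : `](2 * k), (2 * s)[%classic t -> mu.-integrable setT (EFin \o F t).
  by move=> /tpos tk; apply: intf; apply: lt_trans tk; rewrite mulr_gt0.
have deF t y : `](2 * k), (2 * s)[%classic t -> setT y -> derivable (F ^~ y) t 1.
  by move=> _ _; have [] := dF t y.
pose G y := k^-1 * (expR (- k * y) * f y).
have G0 y : 0 <= G y by rewrite /G !mulr_ge0 ?expR_ge0// invr_ge0 ltW.
have iG : mu.-integrable setT (EFin \o G) by apply: integrable_mulr => //; exact: intf.
have dFE t y : partial1of2 F t y = - (expR (- t * y) * (y * f y)).
  by rewrite partial1of2E; have [_ ->] := dF t y.
have bF t y : `](2 * k), (2 * s)[%classic t -> setT y -> `|partial1of2 F t y| <= G y.
  move=> /tpos tk _; rewrite dFE normrN.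
  have [y0|y0] := leP y 0; first by rewrite f_eq0// !mulr0 normr0.
  rewrite ger0_norm ?mulr_ge0 ?expR_ge0// ?(ltW y0)//.
  rewrite /G mulrA [X in _ <= X]mulrA; apply: ler_wpM2r => //.
  apply: le_trans (mulr_expRN y k0); rewrite mulrC; apply: ler_wpM2l; first exact: ltW.
  by rewrite ler_expR !mulNr lerN2 ler_pM2r// ltW.
have d := derivable_under_integral measurableT sI iF deF G0 iG bF.
have e := differentiation_under_integral measurableT sI iF deF G0 iG bF.
apply: DeriveDef; first exact: d.
rewrite -derive1E e; under eq_Rintegral do rewrite dFE -mulN1r.
rewrite RintegralZl//; last first.
  exact: integrable_laplace_real half_line_mulid (laplace_mulid_lty s0).
by rewrite mulN1r fine_laplaceE.
Qed.

End laplace_derivative.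

(** * The linear equation for the transform *)

Section ode.
Context (R : realType).
Local Notation mu := (@lebesgue_measure R).
Implicit Types (s x u : R).
(** In the application T is the transform of the tail of Pi, K the integral of that tail, p the
    total mass of Pi, and C bounds g on [1, +oo[. *)
Variables (alpha0 c r q K C p : R) (T g : R -> R).
Hypotheses (r0 : 0 < r) (c0 : 0 < c) (alpha00 : 0 <= alpha0) (q0 : 0 <= q).
Hypothesis cT : forall s, 0 < s -> {for s, continuous T}.
Hypothesis T0K : forall s, 0 <= s -> 0 <= T s <= K.
Hypothesis Tp : forall s, 0 < s -> s * T s <= p.

Let kap s := alpha0 * s ^+ 2 + c * s - s * T s - q.

Hypothesis dg : forall s, 0 < s -> is_derive s 1 g ((kap s * g s - s) / (r * s)).
Hypothesis g0C : forall s, 1 <= s -> 0 <= g s <= C.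

Let I s : R := s `^ (q / r) * expR (- (alpha0 / (2 * r)) * s ^+ 2 - c / r * s +
        r^-1 * \int[mu]_(z in `[0, s]) T z).

Let I_gt0 s : 0 < s -> 0 < I s.
Proof. by move=> s0; rewrite mulr_gt0 ?expR_gt0// powR_gt0. Qed.

Let mT : measurable_fun (`]0, +oo[%classic : set R) T.
Proof.
apply: open_continuous_measurable_fun; first exact: interval_open.
by move=> x; rewrite inE/= in_itv/= andbT; exact: cT.
Qed.

Let intT u : mu.-integrable (`[0, u]%classic : set R) (EFin \o T).
Proof.
apply: measurable_bounded_integrable => //.
- by have /= -> := lebesgue_measure_itv `[0, u]; case: ifPn => _; rewrite -?EFinB ltry.
- have m1 : measurable_fun (`[0, +oo[%classic : set R) T.
    rewrite -(@setU1itv _ _ +oo%O 0 false)//.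
    by apply/measurable_funU => //; split => //; exact: measurable_fun_set1.
  by apply: measurable_funS m1 => //; exact: subset_itvl.
- exists K; split; first exact: num_real.
  move=> M KM z /=; rewrite in_itv/= => /andP[z0 _].
  by have /andP[h1 h2] := T0K z0; rewrite ger0_norm// (le_trans h2)// ltW.
Qed.

Let dI s : 0 < s -> is_derive s 1 I (- (kap s / (r * s)) * I s).
Proof.
move=> s0.
have sN0 : s != 0 by rewrite gt_eqF.
have rN0 : r != 0 by rewrite gt_eqF.
have s1 : s < s + 1 by rewrite ltrDl.
have [d1 e1] := @continuous_FTC1 R T (BLeft 0) s (s + 1) s1 (intT (s + 1)) s0 (cT s0).
have dJ : is_derive s 1 (fun x => \int[mu]_(z in `[0, x]) T z) (T s).
  by apply: DeriveDef; [exact: d1|rewrite -derive1E; exact: e1].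
have dP := is_derive1_powR (q / r) s0.
pose e x : R := - (alpha0 / (2 * r)) * x ^+ 2 - c / r * x +
  r^-1 * \int[mu]_(z in `[0, x]) T z.
have de : is_derive s 1 e (- (alpha0 / r) * s - c / r + r^-1 * T s).
  rewrite (_ : e = ((- (alpha0 / (2 * r))) *: (fun x : R => x ^+ 2) - (c / r) *: (@id R)) +
    r^-1 *: (fun x : R => \int[mu]_(z in `[0, x]) T z)).
    have dq : is_derive s 1 (fun x : R => x ^+ 2) (2 * s).
      rewrite (_ : (fun _ => _) = (@id R) * (@id R)); last by apply/funext.
      by apply: (is_derive_eq (is_deriveM _ _)); rewrite /GRing.scale/=; ring.
    apply: (is_derive_eq (is_deriveD (is_deriveB (is_deriveZ _ dq)
      (is_deriveZ _ (is_derive_id s 1))) (is_deriveZ _ dJ))).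
    by rewrite /GRing.scale/=; field.
  by apply/funext => x.
have dE := @is_derive1_comp _ expR e s _ _ (is_derive_expR _) de.
change (is_derive s 1 ((fun x => x `^ (q / r)) * (expR \o e))
  (- (kap s / (r * s)) * (s `^ (q / r) * expR (e s)))).
apply: is_derive_eq; rewrite /GRing.scale/= /kap.
have -> : s `^ (q / r - 1) = s `^ (q / r) / s.
  by rewrite powRB ?powRr1 ?(ltW s0)//; apply/implyP.
by field; rewrite ?rN0 ?sN0.
Qed.

(** Beyond this point c s is at least 2 (p + q), so kap s >= c s - p - q >= c s / 2. The summand 1
    also places it where g is bounded. *)
Let s0_ := 1 + 2 * (p + q) / c.

Let p0 : 0 <= p.
Proof.
have := Tp (@ltr01 R); rewrite mul1r; apply: le_trans.
by have /andP[] := T0K (@ler01 R).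
Qed.

Let s0_ge1 : 1 <= s0_.
Proof. by rewrite /s0_ lerDl !mulr_ge0 ?addr_ge0// invr_ge0 ltW. Qed.

Let kap_ge s : s0_ <= s -> c / 2 <= kap s / s.
Proof.
move=> s0s; have s1 := le_trans s0_ge1 s0s.
have s0 : 0 < s by apply: lt_le_trans s1.
rewrite ler_pdivlMr// /kap.
have h1 : s * T s <= p by exact: Tp.
have h2 : 0 <= alpha0 * s ^+ 2 by rewrite mulr_ge0// sqr_ge0.
have h3 : 2 * (p + q) <= c * s.
  rewrite -ler_pdivrMl// mulrC; apply: le_trans s0s; rewrite /s0_ lerDr//.
have -> : c / 2 * s = c * s / 2 by ring.
lra.
Qed.

(** The product H of I with exp (c x / (2 r)) has logarithmic derivative c / (2 r) - kap x / (r x),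
    which is nonpositive beyond [s0_]. The rate comes from the drift, so it also serves for alpha0 =
    0, where I has no Gaussian factor. *)
Let I_bound s : s0_ <= s -> I s <= I s0_ * expR (c / (2 * r) * s0_) * expR (- (c / (2 * r) * s)).
Proof.
move=> s0s.
pose H x := I x * expR (c / (2 * r) * x).
have dH x : 0 < x -> is_derive x 1 H ((c / (2 * r) - kap x / (r * x)) * H x).
  move=> x0; have dIx := dI x0.
  have d1 : is_derive x 1 (fun x : R => c / (2 * r) * x) (c / (2 * r)).
    rewrite (_ : (fun _ => _) = (c / (2 * r)) *: (@id R)).
      by apply: is_derive_eq; rewrite /GRing.scale/= mulr1.
    by apply/funext => z; rewrite /GRing.scale/=.
  have d2 := @is_derive1_comp _ expR _ x _ _ (is_derive_expR _) d1.
  change (is_derive x 1 (I * (expR \o (fun x : R => c / (2 * r) * x)))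
    ((c / (2 * r) - kap x / (r * x)) * (I x * expR (c / (2 * r) * x)))).
  by apply: is_derive_eq; rewrite /GRing.scale/=; ring.
have s00 : 0 < s0_ by apply: lt_le_trans s0_ge1.
have : H s <= H s0_.
  apply: (@ler0_derive1_nincry _ H s0_) => //.
  - move=> x; rewrite in_itv/= andbT => sx.
    by have [] := dH x (lt_trans s00 sx).
  - move=> x; rewrite in_itv/= andbT => sx; have x0 := lt_trans s00 sx.
    rewrite derive1E; have [_ ->] := dH x x0.
    apply: mulr_le0_ge0; last by rewrite mulr_ge0 ?expR_ge0// ltW// I_gt0.
    have -> : c / (2 * r) = c / 2 / r by field; rewrite gt_eqF.
    have -> : kap x / (r * x) = kap x / x / r by field; rewrite !gt_eqF.
    rewrite subr_le0; apply: ler_wpM2r; first by rewrite invr_ge0 ltW.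
    exact: kap_ge (ltW sx).
  - apply: derivable_within_continuous => x; rewrite in_itv/= andbT => sx.
    by have [] := dH x (lt_le_trans s00 sx).
rewrite /H -ler_pdivlMr ?expR_gt0// => h; apply: le_trans h _.
by rewrite expRN.
Qed.

(** This removes the boundary term at infinity, and so singles out one solution of the linear
    equation. *)
Let cvg_Ig : I s * g s @[s --> +oo] --> 0.
Proof.
have C0 : 0 <= C by have /andP[h1 h2] := g0C (lexx 1); exact: le_trans h2.
pose A := I s0_ * expR (c / (2 * r) * s0_) * C.
apply: (@squeeze_cvgr _ _ _ _ (cst 0) (fun s => A * expR (- (c / (2 * r) * s)))).
- near=> s.
  have ss : s0_ <= s by near: s; apply: nbhs_pinfty_ge; exact: num_real.
  have s1 := le_trans s0_ge1 ss.
  have Is := I_gt0 (lt_le_trans ltr01 s1).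
  have /andP[h1 h2] := g0C s1.
  rewrite mulr_ge0 ?(ltW Is)//=.
  apply: le_trans (ler_pM (ltW Is) h1 (I_bound ss) h2) _.
  by rewrite /A mulrAC.
- exact: cvg_cst.
- rewrite -[X in _ --> X](mulr0 A); apply: cvgMr.
  apply: (@cvg_comp _ _ _ (fun s : R => c / (2 * r) * s) (fun x => expR (- x))); last exact: cvgr_expR.
  apply: gt0_cvgMry; last exact: cvg_id.
  by rewrite divr_gt0// mulr_gt0.
Unshelve. all: by end_near. Qed.

Lemma ode_solution s : 0 < s -> \int[mu]_(y in `]s, +oo[) I y = r * I s * g s.
Proof.
move=> s0.
have cI x : 0 < x -> derivable I x 1 by move=> /dI[].
have mI : measurable_fun (`]s, +oo[%classic : set R) (EFin \o I).
  apply/measurable_EFinP; apply: open_continuous_measurable_fun; first exact: interval_open.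
  move=> x; rewrite inE/= in_itv/= andbT => sx.
  by apply: differentiable_continuous; apply/derivable1_diffP/cI; exact: lt_trans sx.
rewrite /Rintegral integral_itv_obnd_cbnd// -/(Rintegral _ _ _).
pose F x := - r * (I x * g x).
have dF x : 0 < x -> is_derive x 1 F (I x).
  move=> x0; have dIx := dI x0; have dgx := dg x0.
  change (is_derive x 1 ((- r) *: (I * g)) (I x)).
  apply: is_derive_eq; rewrite /GRing.scale/=.
  by field; rewrite !gt_eqF.
rewrite (@Rintegral_ge0_continuous_FTC2y _ I F s 0).
- by rewrite /F sub0r; ring.
- by move=> x sx; apply/ltW/I_gt0; exact: lt_le_trans sx.
- apply: derivable_within_continuous => x; rewrite in_itv/= andbT => sx.
  by apply: cI; exact: lt_le_trans sx.
- by rewrite -[X in _ --> X](mulr0 (- r)); apply: cvgMr; exact: cvg_Ig.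
- by move=> x sx; have [] := dF x (lt_trans s0 sx).
- have : {for s, continuous F}.
    by apply: differentiable_continuous; apply/derivable1_diffP; have [] := dF s s0.
  exact: cvg_at_right_filter.
- move=> x; rewrite in_itv/= andbT => sx; rewrite derive1E.
  by have [_ ->] := dF x (lt_trans s0 sx).
Qed.

End ode.

(** * Tails of finite measures *)

Section levy_tail.
Context (R : realType).
Local Notation mu := (@lebesgue_measure R).
Variable Pi : {finite_measure set R -> \bar R}.
Hypothesis mean : (\int[Pi]_(x in `]0%R, +oo[) x%:E < +oo)%E.
Implicit Types x y s : R.

Lemma tailE x : (tail Pi x)%:E = Pi `]x, +oo[%classic.
Proof. by rewrite /tail fineK// fin_num_measure. Qed.

Lemma tail_ge0 x : 0 <= tail Pi x.
Proof. by rewrite fine_ge0. Qed.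

Lemma tail_le x : tail Pi x <= fine (Pi setT).
Proof.
rewrite -lee_fin tailE fineK; last exact: fin_num_measure.
by apply: le_measure; rewrite ?inE.
Qed.

Lemma tail_nonincreasing x y : x <= y -> tail Pi y <= tail Pi x.
Proof.
move=> xy; rewrite -lee_fin !tailE; apply: le_measure; rewrite ?inE//.
exact: subset_itvr.
Qed.

Lemma measurable_tail (D : set R) : measurable D -> measurable_fun D (tail Pi).
Proof.
move=> mD.
rewrite (_ : tail Pi = (fun x => - (- tail Pi x))); last by apply/funext => x; rewrite opprK.
apply: measurableT_comp => //; apply: nondecreasing_measurable => // x y xy.
by rewrite lerN2 tail_nonincreasing.
Qed.

Lemma half_line_tail : half_line (half_line_fun (tail Pi)).
Proof.
by apply: half_line_half_line_fun => [|x _]; [exact: measurable_tail|exact: tail_ge0].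
Qed.

(** By Tonelli on the region 0 < x < y, the integral of the tail is the mean of Pi. *)
Lemma integral_tail_lty : (\int[mu]_x half_line_fun (tail Pi) x < +oo)%E.
Proof.
pose A := [set z : R * R | (0 < z.1) && (z.1 < z.2)].
have mA : measurable (A : set (measurableTypeR R * R)).
  rewrite (_ : A = (fun z : measurableTypeR R * R => (0 < z.1) && (z.1 < z.2)) @^-1` [set true]).
    rewrite -[X in measurable X]setTI.
    apply: measurable_and => //; apply: measurable_fun_ltr => //.
  by apply/seteqP; split => z.
pose h (z : measurableTypeR R * R) : \bar R := (\1_A z)%:E.
have mh : measurable_fun setT h by apply/measurable_EFinP; exact: measurable_indic.
have h0 z : (0 <= h z)%E by rewrite lee_fin.
have -> : (\int[mu]_x half_line_fun (tail Pi) x = \int[mu]_x \int[Pi]_y h (x, y))%E.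
  apply: eq_integral => x _; rewrite half_line_funE; case: ifPn => x0.
    rewrite tailE -(setIT `]x, +oo[%classic) -integral_indic//.
    apply: eq_integral => y _; rewrite /h !indicE; congr (_ %:R)%:E.
    by congr nat_of_bool; apply/idP/idP; rewrite !inE /A /= in_itv/= andbT x0.
  rewrite integral0_eq// => y _; rewrite /h indicE memNset//=.
  by rewrite /A /= (negbTE x0).
rewrite (fubini_tonelli h)//.
have -> : (\int[Pi]_y \int[mu]_x h (x, y) = \int[Pi]_(y in `]0%R, +oo[) y%:E)%E.
  rewrite [RHS]integral_mkcond; apply: eq_integral => y _.
  transitivity (mu `]0, y[%classic).
    by rewrite -(setIT `]0, y[%classic) -integral_indic.
  have /= -> := lebesgue_measure_itv `]0, y[; rewrite lte_fin patchE.
  have -> : (y \in `]0%R, +oo[%classic) = (0 < y).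
    by apply/idP/idP; rewrite inE/= in_itv/= andbT.
  by case: ifPn; rewrite ?sube0.
exact: mean.
Qed.

Let L s := laplace (half_line_fun (tail Pi)) s.

Let K := fine (\int[mu]_x half_line_fun (tail Pi) x)%E.

Let Kfin : (\int[mu]_x half_line_fun (tail Pi) x)%E \is a fin_num.
Proof.
rewrite ge0_fin_numE ?integral_tail_lty//; apply: integral_ge0 => x _.
by have [_ h _] := half_line_tail; exact: h.
Qed.

Let L_le s : 0 <= s -> (L s <= K%:E)%E.
Proof.
move=> s0; have [mt t0 tz] := half_line_tail.
rewrite /K fineK//; apply: ge0_le_integral => //.
- by move=> x _; rewrite mule_ge0 ?lee_fin ?expR_ge0.
- exact: measurable_expRM_mul.
- move=> x _; have [x0|x0] := leP x 0; first by rewrite tz// mule0.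
  rewrite -[leRHS]mul1e; apply: lee_wpmul2r => //.
  by rewrite lee_fin -expR0 ler_expR mulNr oppr_le0 mulr_ge0// ltW.
Qed.

(** [tail_laplace] is the [fine] of an integral, so the equality rests on finiteness; the bound K
    supplies it down to s = 0. *)
Lemma laplace_tail s : 0 <= s -> L s = (tail_laplace Pi s)%:E.
Proof.
move=> s0; rewrite /tail_laplace /Rintegral fineK.
  rewrite /L laplace_half_line; last exact: half_line_tail.
  apply: eq_integral => x; rewrite inE/= in_itv/= andbT => x0.
  by rewrite half_line_funE x0 EFinM.
rewrite (_ : (\int[mu]_(x in _) _)%E = L s).
  rewrite ge0_fin_numE; first by rewrite (le_lt_trans (L_le s0))// ltry.
  by apply: laplace_ge0; have [] := half_line_tail.
rewrite /L laplace_half_line; last exact: half_line_tail.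
apply: eq_integral => x; rewrite inE/= in_itv/= andbT => x0.
by rewrite half_line_funE x0 EFinM.
Qed.

Lemma tail_laplace_bound s : 0 <= s -> 0 <= tail_laplace Pi s <= K.
Proof.
move=> s0; rewrite -!lee_fin -laplace_tail// L_le// andbT.
by apply: laplace_ge0; have [] := half_line_tail.
Qed.

(** The tail is at most the total mass times [heaviside], whose transform is 1 / s. *)
Lemma tail_laplace_decay s : 0 < s -> s * tail_laplace Pi s <= fine (Pi setT).
Proof.
move=> s0; have P0 : 0 <= fine (Pi setT) by rewrite fine_ge0.
rewrite mulrC -ler_pdivlMr// -lee_fin -laplace_tail ?(ltW s0)//.
rewrite EFinM -(laplace_heaviside s0) -laplaceZ//; last exact: half_line_heaviside.
have [mt t0 tz] := half_line_tail; have [mH H0 Hz] := @half_line_heaviside R.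
apply: ge0_le_integral => //.
- by move=> x _; rewrite mule_ge0 ?lee_fin ?expR_ge0.
- exact: measurable_expRM_mul.
- by apply: measurable_expRM_mul; exact: measurable_funeM.
- move=> x _; apply: lee_wpmul2l; first by rewrite lee_fin expR_ge0.
  rewrite half_line_funE /heaviside indicE.
  have -> : (x \in `]0%R, +oo[%classic) = (0 < x).
    by apply/idP/idP; rewrite inE/= in_itv/= andbT.
  by case: ifPn => _; rewrite /= ?mule0// mule1 lee_fin tail_le.
Qed.

Lemma continuous_tail_laplace s : 0 < s -> {for s, continuous (tail_laplace Pi)}.
Proof.
move=> s0.
pose f : R -> R := tail Pi \_ `]0, +oo[.
have hE : half_line_fun (tail Pi) = EFin \o f.
  by rewrite /half_line_fun restrict_EFin.
have hh : half_line (EFin \o f) by rewrite -hE; exact: half_line_tail.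
have Lf t : 0 < t -> (laplace (EFin \o f) t < +oo)%E.
  by move=> t0; rewrite -hE -/(L t) laplace_tail ?ltry// ltW.
have [d _] := is_derive_laplace hh Lf s0.
have c : {for s, continuous (fun t => fine (laplace (EFin \o f) t))}.
  by apply: differentiable_continuous; apply/derivable1_diffP.
have e t : 0 < t -> fine (laplace (EFin \o f) t) = tail_laplace Pi t.
  by move=> t0; rewrite -hE -/(L t) laplace_tail// ltW.
have {}c : fine (laplace (EFin \o f) t) @[t --> s] --> tail_laplace Pi s.
  by rewrite -e//; exact: c.
apply: cvg_trans c; apply: near_eq_cvg; near=> t; apply: e.
by near: t; exact: lt_nbhsr.
Unshelve. all: by end_near. Qed.

End levy_tail.

(** * The transform of the scale derivative *)

Section scale_derivative_transform.
Context (R : realType).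
Local Notation mu := (@lebesgue_measure R).
Variables (r a c alpha0 q : R) (Pi : {finite_measure set R -> \bar R}).
Hypotheses (hr : 0 < r) (hc : 0 < c) (halpha0 : 0 <= alpha0) (hq : 0 <= q).
Hypothesis hPi_mean : (\int[Pi]_(x in `]0%R, +oo[) x%:E < +oo)%E.
Variables Wq wq wa : R -> R.
Hypothesis hWq : scale_function alpha0 c q Pi Wq.
Hypothesis hwq : scale_derivative alpha0 Pi 0 Wq wq.
Hypothesis hwa_volterra : volterra_equation alpha0 c r a wq wa.
Hypothesis hwa_ge0 : forall x : R, a < x -> 0 <= wa x.
Hypothesis hwa_meas : measurable_fun `]a, +oo[%classic wa.
Hypothesis hwa_laplace : forall s : R, 0 < s -> (shifted_laplace a wa s < +oo)%E.
Implicit Types s : R.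

Let f : R -> R := (fun y => wa (a + y)) \_ `]0, +oo[.

Let fE : half_line_fun (fun y => wa (a + y)) = EFin \o f.
Proof. by rewrite /half_line_fun /f restrict_EFin. Qed.

Let f_mE : half_line_fun (fun y => y * wa (a + y)) = EFin \o (fun y => y * f y).
Proof.
apply/funext => y; rewrite half_line_funE /= /f patchE.
have -> : (y \in `]0%R, +oo[%classic) = (0 < y).
  by apply/idP/idP; rewrite inE/= in_itv/= andbT.
by case: ifPn => // _; rewrite mulr0.
Qed.

Let hf : half_line (EFin \o f).
Proof. by rewrite -fE; exact: half_line_shift. Qed.

Let hm : half_line (EFin \o (fun y => y * f y)).
Proof. exact: half_line_mulid. Qed.

Let Lf s : 0 < s -> (laplace (EFin \o f) s < +oo)%E.
Proof. by move=> s0; rewrite -fE -shifted_laplaceE// hwa_laplace. Qed.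

Let u s := fine (laplace (EFin \o f) s).
Let m s := fine (laplace (EFin \o (fun y => y * f y)) s).

Let uE s : 0 < s -> laplace (EFin \o f) s = (u s)%:E.
Proof.
move=> s0; rewrite /u fineK// ge0_fin_numE ?Lf//.
by apply: laplace_ge0; have [] := hf.
Qed.

Let mE s : 0 < s -> laplace (EFin \o (fun y => y * f y)) s = (m s)%:E.
Proof.
move=> s0; rewrite /m fineK// ge0_fin_numE ?laplace_mulid_lty//.
by apply: laplace_ge0; have [] := hm.
Qed.

Let N : set R := [set x | Pi [set x] != 0%E].

Let cN : countable N.
Proof. by apply: countable_atoms => t; exact: measurable_set1. Qed.

Let dW t : 0 < t -> ~ N t -> is_derive t 1 Wq (wq t).
Proof.
move=> t0 Nt; apply: hwq => // _; rewrite subr0.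
by apply/eqP/negPn/negP.
Qed.

Let ndW x y : 0 <= x -> x <= y -> Wq x <= Wq y.
Proof. exact: scale_nondecreasing hWq x y. Qed.

Let cW : {within `[0, +oo[, continuous Wq}.
Proof. exact: scale_fun_continuous hWq. Qed.

Let v := positive_part_on_half_line wq.

Let W0 := Wq 0.

Let W0E : W0 = (if 0 < alpha0 then 0 else c^-1).
Proof. exact: scale_at0 hWq. Qed.

Let W0_ge0 : 0 <= W0.
Proof. exact: (scale_ge0 hWq (lexx 0)). Qed.

(** Division of kappa W_q(0) by s^2 leaves alpha0 W_q(0) as a constant term, which would be the
    transform of an atom and not of a function; it vanishes because W_q(0) = 0 when alpha0 > 0. *)
Let alpha0_W0 : alpha0 * W0 = 0.
Proof.
rewrite W0E; case: ifPn => [_|]; first by rewrite mulr0.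
rewrite -leNgt => a0; have -> : alpha0 = 0 by apply: le_anti; rewrite a0.
by rewrite mul0r.
Qed.

Let T s := tail_laplace Pi s.
Let kap s := kappa alpha0 c q Pi s.

Let kap_gt0 : \forall s \near +oo, 0 < kap s.
Proof.
near=> s.
have s0 : 0 < s by near: s; exact: nbhs_pinfty_gt.
have sb : (fine (Pi setT) + q) / c < s.
  by near: s; apply: nbhs_pinfty_gt; exact: num_real.
have := tail_laplace_decay hPi_mean s0.
move: sb; rewrite ltr_pdivrMr// /kap /kappa => h1 h2.
have h3 : 0 <= alpha0 * s ^+ 2 by rewrite mulr_ge0// sqr_ge0.
by rewrite mulrC in h1; lra.
Unshelve. all: by end_near. Qed.

(* The transform of the Volterra equation, after eliminating the transform of
   w_q through s / kappa - W_q(0). *)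
Let transform_eq_near : \forall s \near +oo,
  s = r * s * m s + kap s * (u s + W0).
Proof.
near=> s.
have s0 : 0 < s by near: s; exact: nbhs_pinfty_gt.
have k0 : 0 < kap s by near: s; exact: kap_gt0.
have LW : shifted_laplace 0 Wq s = (kap s)^-1%:E.
  by near: s; exact: scale_laplace hWq.
have Lv := laplace_derivative ndW cW cN dW W0_ge0 s0.
have hv := half_line_positive_part ndW cW cN dW.
(* An infinite transform of [v] would make that of W_q infinite, but the latter is 1 / kap s. *)
have vfin : laplace v s \is a fin_num.
  rewrite ge0_fin_numE; last by apply: laplace_ge0; have [] := hv.
  rewrite ltey; apply/eqP => voo; move: Lv.
  by rewrite -/v voo LW gt0_muley ?lte_fin ?invr_gt0.
have wq0 := half_line_derivative_ge0 ndW dW.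
have mwq := half_line_derivative_measurable ndW cW cN dW.
have := laplace_volterra hwa_ge0 hwa_meas hc hr cN wq0 mwq hwa_volterra s W0E.
move: Lv; rewrite LW -/v -(fineK vfin) f_mE fE uE// mE//.
rewrite -!EFinM -!EFinD => -[h1] [h2].
have h3 : fine (laplace v s) = s / kap s - W0.
  move: h1; move: (fine _) => z; rewrite -/W0 => h1; apply/eqP; rewrite eq_sym subr_eq h1.
  by apply/eqP; field; rewrite gt_eqF.
move: h2; rewrite h3 => h2.
have : kap s * (s / kap s - W0) = kap s * (u s + (W0 * r * m s + r * ((s / kap s - W0) * m s))) by rewrite -h2.
rewrite mulrBr (_ : kap s * (s / kap s) = s); last by field; rewrite gt_eqF.
(* The term W0 r m from the factor c(x) / c(a) cancels the one from the constant in s / kappa -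
   W0. *)
have -> : kap s * (u s + (W0 * r * m s + r * ((s / kap s - W0) * m s))) =
  kap s * u s + r * s * m s by field; rewrite gt_eqF.
by move=> h; rewrite mulrDr; lra.
Unshelve. all: by end_near. Qed.

Let one : R -> \bar R := @heaviside R.
Let hone : half_line one. Proof. exact: half_line_heaviside. Qed.
(** Its transform times s is s T s + q, the part of kappa that carries a minus sign and has to
    change sides. *)
Let k : R -> \bar R := (fun x => half_line_fun (tail Pi) x + q%:E * one x)%E.
Let hk : half_line k.
Proof. by apply: half_lineD; [exact: half_line_tail|exact: half_lineZ]. Qed.

Let Lone s : 0 < s -> laplace one s = (s^-1)%:E. Proof. exact: laplace_heaviside. Qed.

Let Lk s : 0 < s -> laplace k s = (T s + q / s)%:E.
Proof.
move=> s0; rewrite laplaceD ?laplaceZ//; [|exact: half_line_tail|exact: half_lineZ].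
by rewrite Lone// laplace_tail ?(ltW s0).
Qed.

(* Dividing the transform equation by s^2 and moving the negative terms across
   exhibits both sides as transforms of nonnegative functions; injectivity then
   carries it from large s to all s > 0. *)
Let lhs : R -> \bar R :=
  (fun x => one x + convolution one (fun y => convolution k (EFin \o f) y + W0%:E * k y) x)%E.
Let rhs : R -> \bar R :=
  (fun x => (alpha0%:E * (EFin \o f) x + (c * W0)%:E * one x) +
    convolution one (fun y => r%:E * (EFin \o (fun y => (y * f y)%R)) y + c%:E * (EFin \o f) y) x)%E.

Let cW0_ge0 : 0 <= c * W0. Proof. by rewrite mulr_ge0// ltW. Qed.

Let hl1 : half_line (fun y => convolution k (EFin \o f) y + W0%:E * k y)%E.
Proof. by apply: half_lineD; [exact: half_line_convolution|exact: half_lineZ]. Qed.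

Let hr1 : half_line
  (fun y => r%:E * (EFin \o (fun y => (y * f y)%R)) y + c%:E * (EFin \o f) y)%E.
Proof. by apply: half_lineD; apply: half_lineZ => //; exact: ltW. Qed.

Let hr2 : half_line (fun x => alpha0%:E * (EFin \o f) x + (c * W0)%:E * one x)%E.
Proof. by apply: half_lineD; apply: half_lineZ. Qed.

Let hlhs : half_line lhs.
Proof. by apply: half_lineD => //; exact: half_line_convolution. Qed.

Let hrhs : half_line rhs.
Proof. by apply: half_lineD => //; exact: half_line_convolution. Qed.

Let Llhs s : 0 < s ->
  laplace lhs s = (s^-1 + s^-1 * ((T s + q / s) * u s + W0 * (T s + q / s)))%:E.
Proof.
move=> s0; rewrite laplaceD//; last exact: half_line_convolution.
rewrite laplace_convolution// laplaceD//; [|exact: half_line_convolution|exact: half_lineZ].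
by rewrite laplaceZ// laplace_convolution// Lone// Lk// uE.
Qed.

Let Lrhs s : 0 < s ->
  laplace rhs s = (alpha0 * u s + c * W0 * s^-1 + s^-1 * (r * m s + c * u s))%:E.
Proof.
move=> s0; rewrite laplaceD//; last exact: half_line_convolution.
rewrite laplaceD//; [|exact: half_lineZ|exact: half_lineZ].
rewrite laplace_convolution// laplaceD//; [|by apply: half_lineZ => //; exact: ltW..].
by rewrite !laplaceZ ?(ltW hr) ?(ltW hc)// Lone// uE// mE.
Qed.

Let sides_eq s : 0 < s ->
  (s^-1 + s^-1 * ((T s + q / s) * u s + W0 * (T s + q / s)) =
   alpha0 * u s + c * W0 * s^-1 + s^-1 * (r * m s + c * u s)) <->
  s = r * s * m s + kap s * (u s + W0).
Proof.
move=> s0; have sN0 : s != 0 by rewrite gt_eqF.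
(* Multiplying back by s^2 recovers the transform equation up to a multiple of alpha0 W0, which is
   zero. *)
have D : s ^+ 2 * (s^-1 + s^-1 * ((T s + q / s) * u s + W0 * (T s + q / s)) -
    (alpha0 * u s + c * W0 * s^-1 + s^-1 * (r * m s + c * u s))) =
    s - (r * s * m s + kap s * (u s + W0)) + s ^+ 2 * (alpha0 * W0).
  by rewrite /kap /kappa -/(T s); field.
rewrite alpha0_W0 mulr0 addr0 in D.
split => [h|h].
  apply/eqP; rewrite -subr_eq0 -D; apply/eqP.
  by rewrite h subrr mulr0.
have : s ^+ 2 * (s^-1 + s^-1 * ((T s + q / s) * u s + W0 * (T s + q / s)) -
    (alpha0 * u s + c * W0 * s^-1 + s^-1 * (r * m s + c * u s))) = 0.
  by rewrite D -h subrr.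
by move/eqP; rewrite mulf_eq0 expf_eq0 (negbTE sN0) andbF/= subr_eq0 => /eqP.
Qed.

Let transform_eq s : 0 < s -> s = r * s * m s + kap s * (u s + W0).
Proof.
move=> s0; apply/(sides_eq s0)/EFin_inj; rewrite -(Llhs s0) -(Lrhs s0).
have [M [_ hM]] := transform_eq_near.
(* The near-infinity filter gives the equation only for s > M; adding 1 makes both M < t and 0 < t
   strict for all t >= [s1]. *)
pose s1 := Num.max M 0 + 1.
have s1P t : s1 <= t -> M < t /\ 0 < t.
  move=> s1t; split; apply: lt_le_trans s1t.
    by rewrite /s1 ltr_pwDr// le_max lexx.
  by rewrite /s1 ltr_pwDr// le_max lexx orbT.
have eqL t : s1 <= t -> laplace lhs t = laplace rhs t.
  move=> /s1P[Mt t0]; rewrite (Llhs t0) (Lrhs t0); congr EFin.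
  by apply/(sides_eq t0); exact: hM.
have finL t : s1 <= t -> (laplace lhs t < +oo)%E.
  by move=> /s1P[_ t0]; rewrite (Llhs t0) ltry.
exact: (laplace_inj hlhs hrhs eqL finL).
Qed.

Let g s := u s + W0.

Let dg s : 0 < s -> is_derive s 1 g ((kap s * g s - s) / (r * s)).
Proof.
move=> s0.
have du := is_derive_laplace hf Lf s0.
have dW0 := @is_derive_cst R R R W0 s 1.
have := is_deriveD du dW0; rewrite addr0 -/(m s).
rewrite (_ : - m s = (kap s * g s - s) / (r * s))//.
have -> : kap s * g s - s = - (r * s * m s) by have := transform_eq s0; rewrite /g; lra.
by field; rewrite !gt_eqF.
Qed.

Let g_bound s : 1 <= s -> 0 <= g s <= u 1 + W0.
Proof.
move=> s1; have s0 := lt_le_trans (@ltr01 R) s1.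
have u0 : 0 <= u s by apply: fine_ge0; apply: laplace_ge0; have [] := hf.
apply/andP; split; first exact: addr_ge0.
rewrite lerD2r -lee_fin -(uE s0) -(uE (@ltr01 R)).
have [mf f0 fz] := hf.
apply: ge0_le_integral => //.
- by move=> x _; rewrite mule_ge0 ?lee_fin ?expR_ge0//; exact: f0.
- exact: measurable_expRM_mul.
- exact: measurable_expRM_mul.
- move=> x _; have [x0|x0] := leP x 0; first by rewrite fz// !mule0.
  apply: lee_wpmul2r; first exact: f0.
  by rewrite lee_fin ler_expR !mulNr lerN2 ler_pM2r.
Qed.

Lemma shifted_laplace_scale_derivative s : 0 < s ->
  shifted_laplace a wa s =
    (Ibar_q alpha0 c r q Pi s / (r * I_q alpha0 c r q Pi s) - Wq 0)%:E.
Proof.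
move=> s0.
have cT t : 0 < t -> {for t, continuous T} by exact: continuous_tail_laplace.
have TK t : 0 <= t -> 0 <= T t <= fine (\int[mu]_x half_line_fun (tail Pi) x)%E.
  exact: tail_laplace_bound.
have Tp t : 0 < t -> t * T t <= fine (Pi setT) by exact: tail_laplace_decay.
have := ode_solution hr hc halpha0 hq cT TK Tp dg g_bound s0.
rewrite shifted_laplaceE// fE uE// => IE; congr EFin.
rewrite /Ibar_q (_ : \int[mu]_(y in _) _ = r * I_q alpha0 c r q Pi s * g s); last exact: IE.
have I0 : 0 < I_q alpha0 c r q Pi s by rewrite mulr_gt0 ?expR_gt0// powR_gt0.
by rewrite /g -/W0; field; rewrite !gt_eqF.
Qed.

End scale_derivative_transform.

Unset Implicit Arguments.

Theorem theorem3 (R : realType) (d : measure_display) (Omega : measurableType d)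
  (P : probability Omega R)
  (r a c alpha0 q : R) (Pi : {finite_measure set R -> \bar R})
  (hr : 0 < r) (hc : 0 < c) (halpha0 : 0 <= alpha0) (hq : 0 <= q)
  (hPi : Pi `]-oo, 0]%classic = 0%E)
  (hPi_mean : (\int[Pi]_(x in `]0%R, +oo[) x%:E < +oo)%E)
  (B J : R -> {mfun Omega >-> R})
  (hB : brownian_motion P B)
  (hJ : compound_poisson P Pi J)
  (hBJ : independent P (sigma_of `[0, +oo[ (fun (t : R) w => B t w))
                       (sigma_of `[0, +oo[ (fun (t : R) w => J t w)))
  (X : R -> R -> {mfun Omega >-> R})
  (hX : forall x : R, ou_type_process P r a (levy_Y c alpha0 B J) x (X x))
  (Wq wq : R -> R)
  (hWq : scale_function alpha0 c q Pi Wq)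
  (hwq : scale_derivative alpha0 Pi 0 Wq wq)
  (Wa wa : R -> R)
  (hWa : exit_scale_function P q a X Wa)
  (hwa : scale_derivative alpha0 Pi a Wa wa)
  (hwa_volterra : volterra_equation alpha0 c r a wq wa)
  (hwa_ge0 : forall x : R, a < x -> 0 <= wa x)
  (hwa_meas : measurable_fun `]a, +oo[%classic wa)
  (hwa_laplace : forall s : R, 0 < s -> (shifted_laplace a wa s < +oo)%E) :
  forall s : R, 0 < s ->
    shifted_laplace a wa s =
      (Ibar_q alpha0 c r q Pi s / (r * I_q alpha0 c r q Pi s) - Wq 0)%:E /\
    Ibar_q alpha0 c r q Pi s / (r * I_q alpha0 c r q Pi s) - Wq 0 =
      (if 0 < alpha0
       then Ibar_q alpha0 c r q Pi s / (r * I_q alpha0 c r q Pi s)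
       else Ibar_q alpha0 c r q Pi s / (r * I_q alpha0 c r q Pi s) - c^-1).
Proof.
move=> s s0; split; last by rewrite (scale_at0 hWq); case: ifPn => // _; rewrite subr0.
exact: (shifted_laplace_scale_derivative hr hc halpha0 hq hPi_mean hWq hwq
  hwa_volterra hwa_ge0 hwa_meas hwa_laplace s0).
Qed.
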